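(* Let $\Lambda$ be a finitely aligned $k$-graph and $R$ a (nonzero) unital commutative ring. Then the following statements are equivalent. (1) $\Lambda$ is cofinal. (2) The only saturated hereditary subsets of $\Lambda^0$ are $\emptyset$ and $\Lambda^0$. (3) Every graded ideal of $\mathrm{KP}_R(\Lambda)$ is of the form $J\,\mathrm{KP}_R(\Lambda)$ for some ideal $J$ of $R$. (4) For every ideal $I$ of $\mathrm{KP}_R(\Lambda)$, there exists an ideal $J$ of $R$ such that $I\cap \mathrm{KP}_R(\Lambda)_0\subseteq J\,\mathrm{KP}_R(\Lambda)\subseteq I$. (5) For every ideal $I$ of $\mathrm{KP}_R(\Lambda)$ containing some $s_v$, where $v\in\Lambda^0$, we have $I=\mathrm{KP}_R(\Lambda)$.
   Context: $\mathbb{N}$ is the set of non-negative integers and $k\ge 1$ is an integer. $\mathbb{N}^k$ carries pointwise addition and the coordinatewise partial order $\le$; $m\vee n$ is the coordinatewise maximum. Ideals are two-sided. **$k$-graphs.** A $k$-graph is a countable small category $\Lambda$ with range and source maps $r,s$, together with a functor $d:\Lambda\to\mathbb{N}^k$ such that whenever $d(\lambda)=m+n$ there are unique $\lambda_1,\lambda_2\in\Lambda$ with $d(\lambda_1)=m$, $d(\lambda_2)=n$, $\lambda=\lambda_1\lambda_2$. Objects (vertices) are identified with the paths of degree $0$; their set is $\Lambda^0$. The composite $\lambda\mu$ is defined iff $s(\lambda)=r(\mu)$. Write $v\Lambda=\{\lambda: r(\lambda)=v\}$ and $v\Lambda w=\{\lambda: r(\lambda)=v,s(\lambda)=w\}$.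 $\mathrm{MCE}(\mu,\nu)$ is the set of paths $\lambda$ with $d(\lambda)=d(\mu)\vee d(\nu)$ and $\lambda=\mu\alpha=\nu\beta$ for some $\alpha,\beta\in\Lambda$, and $\Lambda^{\min}(\mu,\nu)=\{(\alpha,\beta):\mu\alpha=\nu\beta\in\mathrm{MCE}(\mu,\nu)\}$. $\Lambda$ is finitely aligned if $\Lambda^{\min}(\mu,\nu)$ is finite (possibly empty) for all $\mu,\nu$. **Exhaustive sets.** $E\subseteq v\Lambda$ is exhaustive if for every $\lambda\in v\Lambda$ there is $\mu\in E$ with $\Lambda^{\min}(\lambda,\mu)\neq\emptyset$. $v\mathrm{FE}(\Lambda)$ is the collection of finite exhaustive sets $E\subseteq v\Lambda\setminus\{v\}$. **Boundary paths, cofinality.** For $m\in(\mathbb{N}\cup\{\infty\})^k$, $\Omega_{k,m}=\{(p,q)\in\mathbb{N}^k\times\mathbb{N}^k: p\le q\le m\}$ is the $k$-graph with $r(p,q)=(p,p)$, $s(p,q)=(q,q)$, $d(p,q)=q-p$. A boundary path is a degree-preserving functor $x:\Omega_{k,m}\to\Lambda$ such that for all $p\in\mathbb{N}^k$, $p\le m$, and all $E\in x(p,p)\mathrm{FE}(\Lambda)$ there is $\mu\in E$ with $p+d(\mu)\le m$ and $x(p,p+d(\mu))=\mu$. Write $d(x)=m$, $x(n)=x(n,n)$; $\partial\Lambda$ is the set of boundary paths. $\Lambda$ is cofinal if for every $v\in\Lambda^0$ and $x\in\partial\Lambda$ there is $n\in\mathbb{N}^k$, $n\le d(x)$, with $v\Lambda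 x(n)\ne\emptyset$. **Hereditary, saturated.** $H\subseteq\Lambda^0$ is hereditary if $v\in H$ and $v\Lambda w\ne\emptyset$ imply $w\in H$; it is saturated if whenever there is $E\in v\mathrm{FE}(\Lambda)$ with $s(E)\subseteq H$, then $v\in H$. **Kumjian-Pask algebra.** A Kumjian-Pask $\Lambda$-family in an $R$-algebra is a collection $\{S_\lambda,S_{\lambda^*}:\lambda\in\Lambda\}$ (with $S_{v^*}=S_v$ for $v\in\Lambda^0$) such that: (KP1) $S_vS_w=\delta_{v,w}S_v$ for $v,w\in\Lambda^0$; (KP2) $S_\mu S_\nu=S_{\mu\nu}$ and $S_{\nu^*}S_{\mu^*}=S_{(\mu\nu)^*}$ when $s(\mu)=r(\nu)$; (KP3) $S_{\mu^*}S_\nu=\sum_{(\alpha,\beta)\in\Lambda^{\min}(\mu,\nu)}S_\alpha S_{\beta^*}$ for all $\mu,\nu$; (KP4) $\prod_{\mu\in E}(S_v-S_\mu S_{\mu^*})=0$ for all $v\in\Lambda^0$, $E\in v\mathrm{FE}(\Lambda)$. $\mathrm{KP}_R(\Lambda)$ is the universal $R$-algebra generated by a Kumjian-Pask $\Lambda$-family $\{s_\lambda,s_{\lambda^*}\}$ (not necessarily unital). It is $\mathbb{Z}^k$-graded with components $\mathrm{KP}_R(\Lambda)_n=\mathrm{span}_R\{s_\mu s_{\nu^*}: s(\mu)=s(\nu),\ d(\mu)-d(\nu)=n\}$, $n\in\mathbb{Z}^k$. An ideal $I$ is graded if $I=\bigoplus_n (I\cap \mathrm{KP}_R(\Lambda)_n)$.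 For an ideal $J$ of $R$, $J\,\mathrm{KP}_R(\Lambda)$ is the set of finite sums of elements $ra$ with $r\in J$, $a\in\mathrm{KP}_R(\Lambda)$. *)

(* Defs.v *)
From HB Require Import structures.
From mathcomp Require Import all_boot all_order all_algebra generic_quotient.
From mathcomp Require Import boolp classical_sets functions cardinality fsbigop.

Set Implicit Arguments.
Unset Strict Implicit.
Unset Printing Implicit Defensive.

Import GRing.Theory.

Local Open Scope classical_set_scope.
Local Open Scope ring_scope.
Local Open Scope quotient_scope.

(** * Degrees *)

(* Addition on [deg k] is the pointwise one. *)
Notation deg k := {ffun 'I_k -> nat}.

Definition led k (m n : deg k) : Prop := forall i, (m i <= n i)%N.

Definition joind k (m n : deg k) : deg k := [ffun i => maxn (m i) (n i)].

(* (N u {oo})^k, where None stands for oo. *)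
Definition edeg (k : nat) := 'I_k -> option nat.

Definition lede k (n : deg k) (m : edeg k) : Prop :=
  forall i, if m i is Some b then (n i <= b)%N else true.

Definition subz k (m n : deg k) : {ffun 'I_k -> int} :=
  [ffun i => (m i)%:Z - (n i)%:Z].

(** * k-graphs *)

(* [comp] is a total function, but only its values on composable pairs are
   meaningful; for this reason every use of [comp lam mu] in this file is
   guarded by [src lam = rng mu]. The vertices are a separate type, and v is
   identified with the path [idp v] of degree 0. *)
Record kgraph (k : nat) := KGraph {
  vtx : countType;
  mor : countType;
  rng : mor -> vtx;
  src : mor -> vtx;
  idp : vtx -> mor;
  comp : mor -> mor -> mor;
  dg : mor -> deg k;
  rng_idp : forall v, rng (idp v) = v;
  src_idp : forall v, src (idp v) = v;
  rng_comp : forall lam mu, src lam = rng mu -> rng (comp lam mu) = rng lam;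
  src_comp : forall lam mu, src lam = rng mu -> src (comp lam mu) = src mu;
  comp_idl : forall lam, comp (idp (rng lam)) lam = lam;
  comp_idr : forall lam, comp lam (idp (src lam)) = lam;
  compA : forall lam mu nu, src lam = rng mu -> src mu = rng nu ->
    comp lam (comp mu nu) = comp (comp lam mu) nu;
  dg_idp : forall v, dg (idp v) = 0;
  dg_comp : forall lam mu, src lam = rng mu ->
    dg (comp lam mu) = dg lam + dg mu;
  factorization : forall lam (m n : deg k), dg lam = m + n ->
    exists! p : mor * mor,
      [/\ dg p.1 = m, dg p.2 = n, src p.1 = rng p.2 & lam = comp p.1 p.2]
}.

Section KGraphTheory.
Context {k : nat} (Lam : kgraph k).
Implicit Types (v w : vtx Lam) (lam mu nu : mor Lam) (E : set (mor Lam)).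

Definition MCE mu nu : set (mor Lam) := [set lam |
  [/\ dg lam = joind (dg mu) (dg nu),
      exists2 alpha, src mu = rng alpha & lam = comp mu alpha &
      exists2 beta, src nu = rng beta & lam = comp nu beta]].

Definition Lmin mu nu : set (mor Lam * mor Lam) := [set p |
  [/\ src mu = rng p.1, src nu = rng p.2, comp mu p.1 = comp nu p.2 &
      MCE mu nu (comp mu p.1)]].

Definition finitely_aligned : Prop := forall mu nu, finite_set (Lmin mu nu).

Definition exhaustive v E : Prop :=
  (forall mu, E mu -> rng mu = v) /\
  forall lam, rng lam = v -> exists2 mu, E mu & Lmin lam mu !=set0.

(* [FE v E] : E belongs to v FE(Lam). *)
Definition FE v E : Prop := [/\ finite_set E, exhaustive v E & ~ E (idp v)].

(* A degree-preserving functor Omega_{k,m} -> Lam. The values [pobj p] and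
   [pmor p q] are only meaningful for p <= m and p <= q <= m respectively;
   [pmor p q] is the image of the morphism (p, q). *)
Record omega_path (m : edeg k) := OmegaPath {
  pobj : deg k -> vtx Lam;
  pmor : deg k -> deg k -> mor Lam;
  pmor_rng : forall p q, led p q -> lede q m -> rng (pmor p q) = pobj p;
  pmor_src : forall p q, led p q -> lede q m -> src (pmor p q) = pobj q;
  pmor_id : forall p, lede p m -> pmor p p = idp (pobj p);
  pmor_comp : forall p q r, led p q -> led q r -> lede r m ->
    pmor p r = comp (pmor p q) (pmor q r);
  pmor_dg : forall p q, led p q -> lede q m -> p + dg (pmor p q) = q
}.

Definition boundary_path (m : edeg k) (x : omega_path m) : Prop :=
  forall p, lede p m -> forall E, FE (pobj x p) E ->
  exists2 mu, E mu &
    lede (p + dg mu) m /\ pmor x p (p + dg mu) = mu.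

Definition cofinal : Prop :=
  forall v (m : edeg k) (x : omega_path m), boundary_path x ->
  exists2 n, lede n m & exists lam, rng lam = v /\ src lam = pobj x n.

Definition hereditary (H : set (vtx Lam)) : Prop :=
  forall lam, H (rng lam) -> H (src lam).

Definition saturated (H : set (vtx Lam)) : Prop :=
  forall v E, FE v E -> @src k Lam @` E `<=` H -> H v.

End KGraphTheory.

(** * Not necessarily unital algebras *)

Record nualg (R : comNzRingType) := NuAlg {
  nu_sort :> lmodType R;
  numul : nu_sort -> nu_sort -> nu_sort;
  numulA : associative numul;
  numulDl : left_distributive numul +%R;
  numulDr : right_distributive numul +%R;
  numulZl : forall (a : R) x y, numul (a *: x) y = a *: numul x y;
  numulZr : forall (a : R) x y, numul x (a *: y) = a *: numul x y
}.

Notation "x ** y" := (numul x y) (at level 40, left associativity) : ring_scope.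

Section NuAlgTheory.
Context {R : comNzRingType}.
Implicit Types (A B : nualg R).

(* Product of a nonempty list; the value on [::] is junk. *)
Definition nuprod A (s : seq A) : A :=
  if s is x :: s' then foldl (@numul R A) x s' else 0.

Record nualg_hom A B (f : A -> B) : Prop := NuAlgHom {
  nuhomD : forall x y, f (x + y) = f x + f y;
  nuhomZ : forall (a : R) x, f (a *: x) = a *: f x;
  nuhomM : forall x y, f (x ** y) = f x ** f y
}.

Definition rideal (J : set R) : Prop :=
  [/\ J 0, forall a b, J a -> J b -> J (a + b) &
      forall c a, J a -> J (c * a)].

(* Two-sided ideals of the R-algebra A. When A has local units, as KP_R(Lam)
   does, closure under scalars follows from the other conditions. *)
Definition nuideal A (I : set A) : Prop :=
  [/\ I 0, forall x y, I x -> I y -> I (x + y),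
      forall (a : R) x, I x -> I (a *: x) &
      forall x y, I x -> I (x ** y) /\ I (y ** x)].

(* Finite sums of elements a x with a in J and x in X; hence [lincomb setT X]
   is the R-span of X, and [lincomb J setT] is J A. *)
Definition lincomb A (J : set R) (X : set A) : set A := [set x |
  exists2 s : seq (R * A), (forall p, p \in s -> J p.1 /\ X p.2) &
    x = \sum_(p <- s) p.1 *: p.2].

(* I is the internal direct sum of the B n. *)
Definition direct_sum A (T : choiceType) (B : T -> set A) (I : set A) : Prop :=
  (forall x, I x <->
    exists f : T -> A, [/\ finite_set [set n | f n != 0],
      forall n, B n (f n) & x = \sum_(n \in [set: T]) f n]) /\
  (forall f : T -> A, finite_set [set n | f n != 0] ->
    (forall n, B n (f n)) -> \sum_(n \in [set: T]) f n = 0 ->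
    forall n, f n = 0).

End NuAlgTheory.

(** * Kumjian-Pask families and the Kumjian-Pask algebra *)

(* [S lam] is S_lam and [T lam] is S_(lam^* ). The sum in (KP3) is over a
   finite set when Lam is finitely aligned. In (KP4) the product is taken along
   an arbitrary duplicate-free enumeration of E: the factors commute by
   (KP1)-(KP3), and E is nonempty since it is exhaustive. *)
Record kp_family k (Lam : kgraph k) (R : comNzRingType) (A : nualg R)
    (S T : mor Lam -> A) : Prop := KPFamily {
  kp_ghost_vtx : forall v, T (idp v) = S (idp v);
  kp1 : forall v w,
    S (idp v) ** S (idp w) = if v == w then S (idp v) else 0;
  kp2 : forall mu nu, src mu = rng nu ->
    S mu ** S nu = S (comp mu nu) /\ T nu ** T mu = T (comp mu nu);
  kp3 : forall mu nu,
    T mu ** S nu = \sum_(p \in Lmin mu nu) (S p.1 ** T p.2);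
  kp4 : forall v E, FE v E -> forall s : seq (mor Lam), uniq s ->
    [set` s] = E -> nuprod [seq S (idp v) - S mu ** T mu | mu <- s] = 0
}.

(* KP_R(Lam) is the algebra of non-unital polynomial expressions in the
   generators s_lam and s_(lam^* ), two expressions being identified when they
   take the same value in every Kumjian-Pask family. For finitely aligned Lam,
   lemmas [KP_kp_family] and [KP_universal] below show that it is the universal
   algebra generated by a Kumjian-Pask family. *)
Inductive kp_term (R M : Type) : Type :=
| TGen of M
| TGhost of M
| TZero
| TOpp of kp_term R M
| TAdd of kp_term R M & kp_term R M
| TScale of R & kp_term R M
| TMul of kp_term R M & kp_term R M.

Arguments TGen {R M}.
Arguments TGhost {R M}.
Arguments TZero {R M}.

HB.instance Definition _ (R M : Type) := gen_eqMixin (kp_term R M).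
HB.instance Definition _ (R M : Type) := gen_choiceMixin (kp_term R M).

Fixpoint kp_eval (R : comNzRingType) (M : Type) (A : nualg R) (S T : M -> A)
    (t : kp_term R M) : A :=
  match t with
  | TGen lam => S lam
  | TGhost lam => T lam
  | TZero => 0
  | TOpp t => - kp_eval S T t
  | TAdd t u => kp_eval S T t + kp_eval S T u
  | TScale a t => a *: kp_eval S T t
  | TMul t u => kp_eval S T t ** kp_eval S T u
  end.

Section KPAlgebra.
Context {k : nat} (R : comNzRingType) (Lam : kgraph k).
Local Notation term := (kp_term R (mor Lam)).

Definition kp_equiv (t u : term) : Prop :=
  forall (A : nualg R) (S T : mor Lam -> A), kp_family S T ->
  kp_eval S T t = kp_eval S T u.

Definition kp_equivb (t u : term) : bool := `[< kp_equiv t u >].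

Lemma kp_equivb_refl : reflexive kp_equivb.
Proof. by move=> t; apply/asboolP => A S T _. Qed.

Lemma kp_equivb_sym : symmetric kp_equivb.
Proof.
by move=> t u; apply/asboolP/asboolP => + A S T f => /(_ A S T f) ->.
Qed.

Lemma kp_equivb_trans : transitive kp_equivb.
Proof.
move=> u t w /asboolP tu /asboolP uw; apply/asboolP => A S T f.
by rewrite (tu A S T f) (uw A S T f).
Qed.

Canonical kp_equiv_rel :=
  EquivRel kp_equivb kp_equivb_refl kp_equivb_sym kp_equivb_trans.

Definition kp_carrier : Type := {eq_quot kp_equiv_rel}.
HB.instance Definition _ := Choice.on kp_carrier.

Definition kp_class (t : term) : kp_carrier :=
  \pi_({eq_quot kp_equiv_rel}) t.
Definition kp_repr (x : kp_carrier) : term :=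
  generic_quotient.repr (x : {eq_quot kp_equiv_rel}).

Definition kp_lift (A : nualg R) (S T : mor Lam -> A) (x : kp_carrier) : A :=
  kp_eval S T (kp_repr x).

Lemma kp_liftE (A : nualg R) (S T : mor Lam -> A) : kp_family S T ->
  forall t, kp_lift S T (kp_class t) = kp_eval S T t.
Proof.
move=> f t.
have /eqP : kp_repr (kp_class t) = t %[mod {eq_quot kp_equiv_rel}].
  by rewrite /kp_repr generic_quotient.reprK.
by rewrite piE => /asboolP; exact.
Qed.

Lemma kp_ext (x y : kp_carrier) :
  (forall (A : nualg R) (S T : mor Lam -> A), kp_family S T ->
    kp_lift S T x = kp_lift S T y) -> x = y.
Proof.
move=> xy; rewrite -[x](@generic_quotient.reprK _ {eq_quot kp_equiv_rel}).
rewrite -[y](@generic_quotient.reprK _ {eq_quot kp_equiv_rel}).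
by apply/eqP; rewrite piE; apply/asboolP.
Qed.

Definition kp_zero : kp_carrier := kp_class TZero.
Definition kp_opp (x : kp_carrier) := kp_class (TOpp (kp_repr x)).
Definition kp_add (x y : kp_carrier) :=
  kp_class (TAdd (kp_repr x) (kp_repr y)).
Definition kp_scale (a : R) (x : kp_carrier) :=
  kp_class (TScale a (kp_repr x)).
Definition kp_mul (x y : kp_carrier) :=
  kp_class (TMul (kp_repr x) (kp_repr y)).

Let liftE := kp_liftE.

Local Ltac kp_ax law := apply/kp_ext => A S T f;
  by rewrite !liftE//= -?/(kp_lift _ _ _) ?liftE//= -?/(kp_lift _ _ _) law.

Lemma kp_addA : associative kp_add.
Proof. move=> x y z; kp_ax addrA. Qed.

Lemma kp_addC : commutative kp_add.
Proof. move=> x y; kp_ax addrC. Qed.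

Lemma kp_add0 : left_id kp_zero kp_add.
Proof. move=> x; kp_ax add0r. Qed.

Lemma kp_addN : left_inverse kp_zero kp_opp kp_add.
Proof. move=> x; kp_ax addNr. Qed.

HB.instance Definition _ :=
  GRing.isZmodule.Build kp_carrier kp_addA kp_addC kp_add0 kp_addN.

Lemma kp_scaleA a b x : kp_scale a (kp_scale b x) = kp_scale (a * b) x.
Proof. kp_ax scalerA. Qed.

Lemma kp_scale1 : left_id 1 kp_scale.
Proof. move=> x; kp_ax scale1r. Qed.

Lemma kp_scaleDr : right_distributive kp_scale +%R.
Proof. move=> a x y; kp_ax scalerDr. Qed.

Lemma kp_scaleDl x : {morph kp_scale^~ x : a b / a + b}.
Proof. move=> a b; kp_ax scalerDl. Qed.

HB.instance Definition _ := GRing.Zmodule_isLmodule.Build R kp_carrier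
  kp_scaleA kp_scale1 kp_scaleDr kp_scaleDl.

Lemma kp_mulA : associative kp_mul.
Proof. move=> x y z; kp_ax numulA. Qed.

Lemma kp_mulDl : left_distributive kp_mul +%R.
Proof. move=> x y z; kp_ax numulDl. Qed.

Lemma kp_mulDr : right_distributive kp_mul +%R.
Proof. move=> x y z; kp_ax numulDr. Qed.

Lemma kp_mulZl (a : R) (x y : kp_carrier) : kp_mul (a *: x) y = a *: kp_mul x y.
Proof. kp_ax numulZl. Qed.

Lemma kp_mulZr (a : R) (x y : kp_carrier) : kp_mul x (a *: y) = a *: kp_mul x y.
Proof. kp_ax numulZr. Qed.

Definition KP : nualg R := NuAlg kp_mulA kp_mulDl kp_mulDr kp_mulZl kp_mulZr.

Definition kp_s (lam : mor Lam) : KP := kp_class (TGen lam).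
Definition kp_t (lam : mor Lam) : KP := kp_class (TGhost lam).

Lemma kp_lift_hom (A : nualg R) (S T : mor Lam -> A) : kp_family S T ->
  @nualg_hom R KP A (kp_lift S T).
Proof. by move=> f; split=> *; rewrite liftE. Qed.

Lemma KP_kp_family : finitely_aligned Lam -> kp_family kp_s kp_t.
Proof.
move=> fa.
have hom0 (A : nualg R) (g : KP -> A) : nualg_hom g -> g 0 = 0.
  by case=> gD _ _; apply: (addIr (g 0)); rewrite -gD !add0r.
have homN (A : nualg R) (g : KP -> A) : nualg_hom g ->
    forall x, g (- x) = - g x.
  move=> h x; apply: (addIr (g x)).
  by rewrite -(nuhomD h) !addNr; exact: hom0.
have homS (A : nualg R) (g : KP -> A) : nualg_hom g ->
    forall (mu nu : mor Lam) F,
    g (\sum_(p \in Lmin mu nu) F p) = \sum_(p \in Lmin mu nu) g (F p).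
  move=> h mu nu F; rewrite !fsbig_finite; try exact: fa.
  exact: (big_morph g (nuhomD h) (hom0 _ _ h)).
split=> [v|v w|mu nu h|mu nu|v E EF s us sE].
- by apply/kp_ext => A S T f; rewrite !liftE//= (kp_ghost_vtx f).
- apply/kp_ext => A S T f.
  rewrite (nuhomM (kp_lift_hom f)) !liftE//= (kp1 f).
  by case: eqP => _; rewrite ?liftE// (hom0 _ _ (kp_lift_hom f)).
- by split; apply/kp_ext => A S T f; rewrite (nuhomM (kp_lift_hom f));
    rewrite !liftE//= ?(kp2 f h).1 ?(kp2 f h).2.
- apply/kp_ext => A S T f.
  rewrite (nuhomM (kp_lift_hom f)) (homS _ _ (kp_lift_hom f)) !liftE//=.
  rewrite (kp3 f); apply: eq_fsbigr => p _.
  by rewrite (nuhomM (kp_lift_hom f)) !liftE.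
- apply/kp_ext => A S T f; have h := kp_lift_hom f.
  have homP x (l : seq KP) : kp_lift S T (foldl (@numul R KP) x l) =
      foldl (@numul R A) (kp_lift S T x) (map (kp_lift S T) l).
    by elim: l x => //= y l IH x; rewrite IH (nuhomM h).
  have gE mu : kp_lift S T (kp_s (idp v) - kp_s mu ** kp_t mu) =
      S (idp v) - S mu ** T mu.
    by rewrite (nuhomD h) (homN _ _ h) (nuhomM h) !liftE.
  rewrite (hom0 _ _ h) -(kp4 f EF us sE).
  case: s {us sE} => [|mu s]/=; first exact: hom0.
  rewrite homP gE -map_comp; congr foldl.
  exact: eq_map.
Qed.

Lemma KP_universal (A : nualg R) (S T : mor Lam -> A) : kp_family S T ->
  exists! f : KP -> A, [/\ nualg_hom f,
    forall lam, f (kp_s lam) = S lam & forall lam, f (kp_t lam) = T lam].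
Proof.
move=> fST; exists (kp_lift S T); split.
  by split=> [|lam|lam]; [exact: kp_lift_hom|rewrite liftE|rewrite liftE].
move=> g [h gs gt]; apply/funext => x.
suff gE t : g (kp_class t) = kp_eval S T t.
  rewrite /kp_lift -gE /kp_class /kp_repr.
  by rewrite (@generic_quotient.reprK _ {eq_quot kp_equiv_rel}).
have g0 : g 0 = 0 by apply: (addIr (g 0)); rewrite -(nuhomD h) !add0r.
elim: t => [lam|lam||t IH|t IHt u IHu|a t IH|t IHt u IHu] /=.
- exact: gs.
- exact: gt.
- exact: g0.
- have -> : kp_class (TOpp t) = - kp_class t.
    by apply/kp_ext => B S' T' f; rewrite !liftE//= -!/(kp_lift _ _ _) !liftE.
  by rewrite -IH; apply: (addIr (g (kp_class t))); rewrite -(nuhomD h) !addNr.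
- have -> : kp_class (TAdd t u) = kp_class t + kp_class u.
    by apply/kp_ext => B S' T' f; rewrite !liftE//= -!/(kp_lift _ _ _) !liftE.
  by rewrite (nuhomD h) IHt IHu.
- have -> : kp_class (TScale a t) = a *: kp_class t.
    by apply/kp_ext => B S' T' f; rewrite !liftE//= -!/(kp_lift _ _ _) !liftE.
  by rewrite (nuhomZ h) IH.
- have -> : kp_class (TMul t u) = (kp_class t : KP) ** (kp_class u : KP).
    by apply/kp_ext => B S' T' f; rewrite !liftE//= -!/(kp_lift _ _ _) !liftE.
  by rewrite (nuhomM h) IHt IHu.
Qed.

Definition KP_deg (n : {ffun 'I_k -> int}) : set KP :=
  lincomb setT [set x | exists mu nu : mor Lam,
    [/\ src mu = src nu, subz (dg mu) (dg nu) = n & x = kp_s mu ** kp_t nu]].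

Definition graded_ideal (I : set KP) : Prop :=
  nuideal I /\ direct_sum (fun n => I `&` KP_deg n) I.

End KPAlgebra.

Arguments kp_s {k} R {Lam}.
Arguments kp_t {k} R {Lam}.
Arguments KP_deg {k} R Lam.

(* Main.v *)
(* Boundary paths are encoded by filters of paths (their sets of initial
   segments), and KP_R(Lam) acts on the R-valued functions on any shift-invariant
   set of them; it also acts on the functions Z^k -> KP_R(Lam), which proves
   that the grading is a direct sum.

   (1)=>(2): outside a proper saturated hereditary set H one can build, by
   treating all finite exhaustive sets in turn, a boundary path that avoids H.
   (2)=>(3): let J be the set of r with r s_v in I for one, equivalently every,
   vertex v, by (2). If x in I is homogeneous and lam extends or is incompatible
   with each left leg of x, then t_lam x is a combination of ghost paths of a
   single degree, so their coefficients are in J; the other lam are reached from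
   these by induction, using (KP4).
   (3)=>(4): the ideal generated by the degree-zero elements of I is graded.
   (4)=>(5): if s_v is in J KP_R(Lam), evaluating s_v on the constant function 1
   at a boundary path through v gives 1 in J.
   (5)=>(1): if no path leads from v to the boundary path x, the action on the
   functions on the boundary paths unreachable from v kills s_v but not s_x(0). *)

Require Import Defs.
From HB Require Import structures.
From mathcomp Require Import all_boot all_order all_algebra zify.
From mathcomp Require Import boolp classical_sets functions cardinality fsbigop.

Import Defs.

Set Implicit Arguments.
Unset Strict Implicit.
Unset Printing Implicit Defensive.

Import GRing.Theory.

Local Open Scope classical_set_scope.
Local Open Scope ring_scope.

(** * Factorization in k-graphs *)

Section Graph.
Context {k : nat} (Lam : kgraph k).
Implicit Types (v w : vtx Lam) (lam mu nu : mor Lam) (E : set (mor Lam)).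

Lemma degDE (m n : deg k) i : (m + n) i = (m i + n i)%N.
Proof. by rewrite ffunE. Qed.

Lemma deg_addI (m : deg k) : injective (+%R m).
Proof.
move=> a b /ffunP h; apply/ffunP => i.
by have := h i; rewrite !degDE => /addnI.
Qed.

Definition subd (m n : deg k) : deg k := [ffun i => (m i - n i)%N].

Lemma subdK (m n : deg k) : led n m -> n + subd m n = m.
Proof. by move=> h; apply/ffunP => i; rewrite degDE ffunE subnKC. Qed.

Lemma led_addr (m n : deg k) : led m (m + n).
Proof. by move=> i; rewrite degDE leq_addr. Qed.

Lemma led_joindl (m n : deg k) : led m (joind m n).
Proof. by move=> i; rewrite ffunE leq_maxl. Qed.

Lemma led_joindr (m n : deg k) : led n (joind m n).
Proof. by move=> i; rewrite ffunE leq_maxr. Qed.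

Lemma joindC (m n : deg k) : joind m n = joind n m.
Proof. by apply/ffunP => i; rewrite !ffunE maxnC. Qed.

(** The second factors have equal degrees by cancellation, so both pairs are the unique
    factorization of one path. *)
Lemma comp_inj (a b c d : mor Lam) : src a = rng b -> src c = rng d ->
  comp a b = comp c d -> dg a = dg c -> a = c /\ b = d.
Proof.
move=> ab cd e deg_ac.
have deg_bd : dg b = dg d.
  move: (congr1 (@dg _ _) e); rewrite !dg_comp// deg_ac.
  by move/deg_addI.
have [[x y] [_ uniq_xy]] := factorization (dg_comp ab).
have xab : (x, y) = (a, b) by exact: uniq_xy.
have xcd : (x, y) = (c, d) by apply: uniq_xy.
by move: xcd; rewrite xab => -[].
Qed.

Lemma compI lam mu nu : src lam = rng mu -> src lam = rng nu ->
  comp lam mu = comp lam nu -> mu = nu.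
Proof. by move=> h1 h2 e; case: (comp_inj h1 h2 e erefl). Qed.

(** Both [comp lam (idp (src lam))] and [comp (idp (rng lam)) lam] factor [lam] with a first factor
    of degree 0. *)
Lemma dg0 lam : dg lam = 0 -> lam = idp (rng lam).
Proof.
move=> d0; apply: (proj1 (comp_inj (b := idp (src lam)) (d := lam) _ _ _ _)).
- by rewrite rng_idp.
- by rewrite src_idp.
- by rewrite comp_idl comp_idr.
- by rewrite d0 dg_idp.
Qed.

Lemma comp_id_l v lam : v = rng lam -> comp (idp v) lam = lam.
Proof. by move=> ->; exact: comp_idl. Qed.

Lemma comp_id_r v lam : v = src lam -> comp lam (idp v) = lam.
Proof. by move=> ->; exact: comp_idr. Qed.

Lemma initial_segment lam (m : deg k) : led m (dg lam) ->
  exists mu nu, [/\ dg mu = m, src mu = rng nu & lam = comp mu nu].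
Proof.
move=> /subdK /esym /factorization[[mu nu] [[/= dm _ s e] _]].
by exists mu, nu.
Qed.

(** By unique factorization, the initial segment of degree [joind (dg lam) (dg mu)] of the common
    extension begins with both [lam] and [mu]; it is therefore a minimal common extension, and [d]
    is what remains. *)
Lemma min_ext lam mu a b : src lam = rng a -> src mu = rng b ->
  comp lam a = comp mu b ->
  exists p d, [/\ Lmin lam mu p, src p.1 = rng d, src p.2 = rng d,
    a = comp p.1 d & b = comp p.2 d].
Proof.
move=> ha hb e.
have dle : led (joind (dg lam) (dg mu)) (dg (comp lam a)).
  move=> i; rewrite ffunE geq_max {1}dg_comp// e dg_comp//.
  by rewrite !led_addr.
have [t [d [dt std et]]] := initial_segment dle.
have factor x y : src x = rng y -> comp t d = comp x y -> led (dg x) (dg t) ->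
    exists2 c, src x = rng c & t = comp x c /\ y = comp c d.
  move=> xy te lx.
  have [x' [c [dx sx et']]] := initial_segment lx.
  have scd : src c = rng d by rewrite -std et' src_comp.
  have := @comp_inj x' (comp c d) x y; case=> //.
  - by rewrite rng_comp.
  - by rewrite compA// -et' te.
  - by move=> xE yE; subst x' y; exists c.
have [c hc [tc ac]] := factor lam a ha (esym et) (eq_ind_r (led _) (led_joindl _ _) dt).
have [c' hc' [tc' bc]] := factor mu b hb (etrans (esym et) e)
   (eq_ind_r (led _) (led_joindr _ _) dt).
have s1 : src c = rng d by rewrite -std tc src_comp.
have s2 : src c' = rng d by rewrite -std tc' src_comp.
exists (c, c'), d; split=> //=; split=> //=; first by rewrite -tc.
by rewrite -tc; split=> //; [exists c|exists c'].
Qed.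

Lemma Lmin_sym mu nu p : Lmin mu nu p -> Lmin nu mu (p.2, p.1).
Proof.
case=> h1 h2 e [dE [a ha ea] [b hb eb]]; split=> //=.
by rewrite -e; split; [rewrite joindC|exists b|exists a].
Qed.

Lemma Lmin_src mu nu p : Lmin mu nu p -> src p.1 = src p.2.
Proof. by case=> h1 h2 /(congr1 (@src _ _)); rewrite !src_comp. Qed.

Lemma Lmin_dg mu nu p : Lmin mu nu p -> dg mu + dg p.1 = dg nu + dg p.2.
Proof. by case=> h1 h2 /(congr1 (@dg _ _)); rewrite !dg_comp. Qed.

Lemma Lmin_dg1 mu nu p q : Lmin mu nu p -> Lmin mu nu q -> dg p.1 = dg q.1.
Proof.
move=> [p1 _ _ [+ _ _]] [q1 _ _ [+ _ _]].
by rewrite !dg_comp// => <- /deg_addI.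
Qed.

Lemma Lmin_inj mu nu p q : Lmin mu nu p -> Lmin mu nu q -> p.1 = q.1 -> p = q.
Proof.
case: p => a b; case: q => c d [/= h1 h2 e _] [/= h3 h4 e' _] ac.
by subst c; congr pair; apply: (@compI nu) => //; rewrite -e -e'.
Qed.

Lemma Lmin_eqdg mu nu : dg mu = dg nu -> mu <> nu -> Lmin mu nu = set0.
Proof.
move=> dE ne; apply/seteqP; split=> // p [h1 h2 e _]; apply: ne.
by case: (comp_inj h1 h2 e dE).
Qed.

Lemma Lmin_diag mu : Lmin mu mu = [set (idp (src mu), idp (src mu))].
Proof.
have h : Lmin mu mu (idp (src mu), idp (src mu)).
  split; rewrite /= ?rng_idp// comp_idr; split.
  - by apply/ffunP => i; rewrite ffunE maxnn.
  - by exists (idp (src mu)); rewrite ?rng_idp// comp_idr.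
  - by exists (idp (src mu)); rewrite ?rng_idp// comp_idr.
apply/seteqP; split=> [p hp|_ ->//].
apply: (Lmin_inj hp h) => /=; case: (hp) => h1 _ _ _.
by rewrite [LHS]dg0 -?h1// (Lmin_dg1 hp h) dg_idp.
Qed.

(** The usual Ext(lam; E), which transports exhaustive sets from the range of [lam] to its
    source. *)
Definition Ext lam E : set (mor Lam) :=
  [set a | exists2 mu, E mu & exists b, Lmin lam mu (a, b)].

Lemma finite_Ext lam E : finitely_aligned Lam -> finite_set E ->
  finite_set (Ext lam E).
Proof.
move=> fa fE.
have -> : Ext lam E = \bigcup_(mu in E) (fst @` Lmin lam mu).
  apply/seteqP; split=> [a [mu Emu [b h]]|a [mu Emu [[c b] h] /= <-]].
    by exists mu => //; exists (a, b).
  by exists mu => //; exists b.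
by apply: bigcup_finite => // mu _; exact: finite_image.
Qed.

(** Some [mu] in [E] has a common extension with [comp lam g]. By [min_ext] it passes through a
    minimal common extension of [lam] and [mu], whose leg is then compatible with [g]. The set
    obtained may contain a vertex, so it need not satisfy [FE]. *)
Lemma exhaustive_Ext lam E : exhaustive (rng lam) E ->
  exhaustive (src lam) (Ext lam E).
Proof.
move=> [_ exE]; split=> [a [mu _ [b []]]//|g rg].
have [|mu Emu [[a b] [/= h1 h2 e _]]] := exE (comp lam g).
  by rewrite rng_comp.
have sga : src g = rng a by rewrite -h1 src_comp.
have [||p [d [hp s1 s2 ga _]]] := @min_ext lam mu (comp g a) b _ h2.
- by rewrite rng_comp.
- by rewrite compA.
exists p.1; first by exists mu => //; exists p.2; case: p hp {s1 s2 ga}.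
by have [q [_ [hq _ _ _ _]]] := min_ext sga s1 ga; exists q.
Qed.

Lemma Ext_extends lam E a : Ext lam E a ->
  exists mu b, [/\ E mu, src lam = rng a, src mu = rng b &
    comp lam a = comp mu b].
Proof. by case=> mu Emu [b [h1 h2 e _]]; exists mu, b. Qed.

Lemma FE_seq v E : FE v E -> exists2 s : seq (mor Lam), uniq s & [set` s] = E.
Proof.
case=> /finite_seqP[s ->] _ _; exists (undup s); first exact: undup_uniq.
by apply/seteqP; split=> x /=; rewrite mem_undup.
Qed.

End Graph.

(** * Boundary paths *)

Section BoundaryFilters.
Context {k : nat} (Lam : kgraph k).
Implicit Types (v w : vtx Lam) (lam mu nu : mor Lam) (E F : set (mor Lam)).

(* A boundary path x is encoded by the set of its initial segments x(0,n). *)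
Record bfilter F : Prop := BFilter {
  bf_ex : exists v, F (idp v);
  bf_init : forall a b, src a = rng b -> F (comp a b) -> F a;
  bf_dir : forall a b, F a -> F b -> exists c d,
    [/\ src a = rng c, src b = rng d, comp a c = comp b d & F (comp a c)];
  bf_bd : forall a E, F a -> FE (src a) E -> exists2 mu, E mu & F (comp a mu)
}.

Lemma bf_rng F a b : bfilter F -> F a -> F b -> rng a = rng b.
Proof.
move=> bF Fa Fb; have [c [d [hc hd e _]]] := bf_dir bF Fa Fb.
by rewrite -(rng_comp hc) e rng_comp.
Qed.

Lemma bf_idp F a : bfilter F -> F a -> F (idp (rng a)).
Proof.
by move=> bF Fa; apply: (bf_init bF (b := a)); rewrite ?src_idp// comp_idl.
Qed.

Lemma bf_uniq F a b : bfilter F -> F a -> F b -> dg a = dg b -> a = b.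
Proof.
move=> bF Fa Fb; have [c [d [hc hd e _]]] := bf_dir bF Fa Fb.
by move/(comp_inj hc hd e) => -[].
Qed.

(** Lifts the exclusion of the vertex in [FE], since sets of the form [Ext] may contain it. *)
Lemma bf_exhaustive F a E : bfilter F -> F a -> finite_set E ->
  exhaustive (src a) E -> exists2 mu, E mu & F (comp a mu).
Proof.
move=> bF Fa fE exE; have [Eid|nE] := pselect (E (idp (src a))).
  by exists (idp (src a)); rewrite ?comp_idr.
exact: (bf_bd bF).
Qed.

(** The shift of a boundary path that begins with [lam]. *)
Definition tailf lam F : set (mor Lam) :=
  [set mu | src lam = rng mu /\ F (comp lam mu)].

(** The boundary path with [lam] prepended; the factor [a] admits also the segments that do not
    extend [lam]. *)
Definition consf lam F : set (mor Lam) :=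
  [set mu | exists nu a,
    [/\ src lam = rng nu, F nu, src mu = rng a & comp mu a = comp lam nu]].

Lemma bfilter_tailf lam F : bfilter F -> F lam -> bfilter (tailf lam F).
Proof.
move=> bF Fl; split.
- by exists (src lam); split; rewrite ?rng_idp// comp_idr.
- move=> a b ab [lab Fab]; rewrite rng_comp// in lab; split=> //.
  by rewrite compA// in Fab; apply: (bf_init bF) Fab; rewrite src_comp.
- move=> a b [la Fa] [lb Fb]; have [c [d []]] := bf_dir bF Fa Fb.
  rewrite !src_comp// => ac bd; rewrite -!compA// => /compI.
  rewrite !rng_comp// => /(_ la lb) e Fc.
  by exists c, d; split=> //; split=> //; rewrite rng_comp.
- move=> a E [la Fa] FEE; case: (FEE) => _ [rE _] _.
  have [|mu Emu Fmu] := bf_bd bF (E := E) Fa; first by rewrite src_comp.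
  have := rE _ Emu => ra.
  exists mu => //; split; first by rewrite rng_comp.
  by rewrite compA.
Qed.

Lemma consf_sub lam F nu : src lam = rng nu -> F nu ->
  consf lam F (comp lam nu).
Proof.
move=> h Fn; exists nu, (idp (src nu)); split=> //.
  by rewrite src_comp// rng_idp.
by rewrite comp_id_r// src_comp.
Qed.

(** For the boundary condition at [a], lengthen [a] by [c] to some [comp lam n], carry the
    exhaustive set along [c] by [Ext], and use the boundary condition of [F] at [n]. *)
Lemma bfilter_consf lam F : finitely_aligned Lam -> bfilter F ->
  F (idp (src lam)) -> bfilter (consf lam F).
Proof.
move=> fa bF Fl; split.
- exists (rng lam), (idp (src lam)), lam; split; rewrite ?src_idp ?rng_idp//.
  by rewrite comp_idl comp_idr.
- move=> a b ab [nu [c [ln Fn]]]; rewrite src_comp// => bc e.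
  by exists nu, (comp b c); split; rewrite ?rng_comp// compA.
- move=> a b [n1 [c1 [ln1 F1 ac1 e1]]] [n2 [c2 [ln2 F2 ac2 e2]]].
  have [d1 [d2 [nd1 nd2 ed Fd]]] := bf_dir bF F1 F2.
  have cd1 : src c1 = rng d1.
    by rewrite -nd1 -(src_comp ac1) e1 src_comp.
  have cd2 : src c2 = rng d2.
    by rewrite -nd2 -(src_comp ac2) e2 src_comp.
  have e3 : comp a (comp c1 d1) = comp lam (comp n1 d1).
    by rewrite compA// e1 compA.
  exists (comp c1 d1), (comp c2 d2); rewrite !rng_comp//; split=> //.
    by rewrite e3 [RHS]compA// e2 -[RHS]compA// ed.
  by rewrite e3; apply: consf_sub => //; rewrite rng_comp.
- move=> a E [n [c [ln Fn ac e]]] [fE exE _].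
  have sc : src c = src n by rewrite -(src_comp ac) e src_comp.
  rewrite ac in exE.
  have [||g Eg Fg] := @bf_exhaustive F n (Ext c E) bF Fn.
  - exact: finite_Ext.
  - by rewrite -sc; exact: exhaustive_Ext.
  have [mu [b [Emu cg mb e']]] := Ext_extends Eg.
  have am : src a = rng mu.
    by rewrite ac -(rng_comp cg) e' rng_comp.
  exists mu => //; exists (comp n g), b; split=> //.
  - by rewrite rng_comp// -sc.
  - by rewrite src_comp.
  - by rewrite -compA// -e' compA// e -compA// -sc.
Qed.

Lemma consf_mem lam F mu : bfilter F -> src lam = rng mu ->
  consf lam F (comp lam mu) <-> F mu.
Proof.
move=> bF lm; split=> [[nu [a [ln Fn]]]|]; last exact: consf_sub.
rewrite src_comp// => ma; rewrite -compA// => /compI; rewrite rng_comp//.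
by move=> /(_ lm ln) e; apply: (bf_init bF ma); rewrite e.
Qed.

Lemma tailf_consf lam F : bfilter F -> F (idp (src lam)) ->
  tailf lam (consf lam F) = F.
Proof.
move=> bF Fl; apply/seteqP; split=> mu.
  by move=> [lm /(consf_mem bF lm)].
move=> Fm; have lm : src lam = rng mu by rewrite (bf_rng bF Fm Fl) rng_idp.
by split=> //; exact: consf_sub.
Qed.

Lemma consf_tailf lam F : bfilter F -> F lam -> consf lam (tailf lam F) = F.
Proof.
move=> bF Fl; apply/seteqP; split=> mu.
  move=> [nu [a [ln [_ Fn] ma e]]]; apply: (bf_init bF ma).
  by rewrite e.
move=> Fm; have [c [d [hc hd e Fc]]] := bf_dir bF Fm Fl.
exists d, c; split=> //.
by split=> //; rewrite -e.
Qed.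

Lemma tailf_comp mu nu F : src mu = rng nu ->
  tailf (comp mu nu) F = tailf nu (tailf mu F).
Proof.
move=> mn; apply/seteqP; split=> a; rewrite /tailf/= src_comp//.
  by move=> [na Fa]; split=> //; rewrite rng_comp// compA.
by move=> [na [_ Fa]]; split=> //; rewrite -compA.
Qed.

Lemma tailf_idp F v : bfilter F -> F (idp v) -> tailf (idp v) F = F.
Proof.
move=> bF Fv; apply/seteqP; split=> a; rewrite /tailf/= src_idp.
  by move=> [->]; rewrite comp_idl.
by move=> Fa; rewrite -(bf_rng bF Fv Fa) rng_idp comp_id_l// -(bf_rng bF Fv Fa) rng_idp.
Qed.

Lemma consf_rng lam F v : bfilter F -> F (idp (src lam)) ->
  consf lam F (idp v) <-> rng lam = v.
Proof.
move=> bF Fl; split=> [[nu [a [ln Fn]]]|<-].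
  rewrite src_idp => va; rewrite comp_id_l// va => ->.
  by rewrite rng_comp.
exists (idp (src lam)), lam; split; rewrite ?src_idp ?rng_idp//.
by rewrite comp_idl comp_idr.
Qed.

Lemma consf_comp mu nu F : finitely_aligned Lam -> src mu = rng nu ->
  bfilter F -> F (idp (src nu)) ->
  consf (comp mu nu) F = consf mu (consf nu F).
Proof.
move=> fa mn bF Fn.
have bn := bfilter_consf fa bF Fn.
have nr : consf nu F (idp (src mu)) by rewrite mn; apply/consf_rng.
have bm := bfilter_consf fa bn nr.
have sub1 : consf mu (consf nu F) (comp mu nu).
  apply/consf_mem => //.
  by rewrite -[X in consf nu F X]comp_idr; apply: consf_sub; rewrite ?rng_idp.
(* A filter is recovered from one member and the tail along it; the right side contains
   [comp mu nu], with tail [F]. *)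
by rewrite -[RHS](consf_tailf bm sub1) tailf_comp// !tailf_consf.
Qed.

End BoundaryFilters.

(** * Translation between boundary paths and filters *)

Section BoundaryPaths.
Context {k : nat} (Lam : kgraph k).
Implicit Types (v w : vtx Lam) (lam mu nu : mor Lam) (E F : set (mor Lam)).

Lemma led0 (n : deg k) : led 0 n.
Proof. by move=> i; rewrite ffunE. Qed.

Lemma lede_led (p q : deg k) (m : edeg k) : led p q -> lede q m -> lede p m.
Proof.
by move=> pq qm i; have := qm i; case: (m i) => // b; apply: leq_trans (pq i).
Qed.

Lemma lede_joind (p q : deg k) (m : edeg k) :
  lede p m -> lede q m -> lede (joind p q) m.
Proof.
move=> pm qm i; have := pm i; have := qm i; case: (m i) => // b.
by rewrite ffunE geq_max => -> ->.
Qed.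

Lemma bfilter_omega_path (m : edeg k) (x : omega_path Lam m) : boundary_path x ->
  bfilter [set lam | exists2 n, lede n m & lam = pmor x 0 n].
Proof.
move=> bx.
have dgx n : lede n m -> dg (pmor x 0 n) = n.
  by move=> nm; have := pmor_dg x (@led0 n) nm; rewrite add0r.
have m0 : lede 0 m by move=> i; rewrite ffunE; case: (m i).
split.
- by exists (pobj x 0), 0; rewrite ?(pmor_id x m0).
- move=> a b ab [n nm e].
  have an : led (dg a) n.
    by rewrite -[n]dgx// -e dg_comp//; exact: led_addr.
  have am := lede_led an nm.
  have e' := pmor_comp x (@led0 _) an nm.
  exists (dg a) => //; rewrite e' in e.
  apply: (proj1 (comp_inj ab _ e _)); last by rewrite dgx.
  by rewrite (pmor_src x (@led0 _) am) (pmor_rng x an nm).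
- move=> _ _ [p pm ->] [q qm ->].
  have jm := lede_joind pm qm; have pj := led_joindl p q.
  have qj := led_joindr p q.
  exists (pmor x p (joind p q)), (pmor x q (joind p q)).
  rewrite -(pmor_comp x (@led0 p) pj jm) -(pmor_comp x (@led0 q) qj jm).
  split=> //; last by exists (joind p q).
    by rewrite (pmor_src x (@led0 p) pm) (pmor_rng x pj jm).
  by rewrite (pmor_src x (@led0 q) qm) (pmor_rng x qj jm).
- move=> _ E [p pm ->]; rewrite pmor_src//; last exact: led0.
  move=> /(bx p pm)[mu Emu [pmu e]]; exists mu => //; exists (p + dg mu) => //.
  by rewrite [RHS](pmor_comp x (@led0 p) (@led_addr _ p (dg mu)) pmu) e.
Qed.

(** Coordinatewise maximum of the degrees of members. For a nonempty set of naturals, the absence of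
    a maximum means unboundedness, hence [None]. *)
Definition filter_deg F : edeg k := fun i =>
  if pselect (exists b, (forall a, F a -> (dg a i <= b)%N) /\
      exists2 a, F a & dg a i = b) is left h
  then Some (projT1 (cid h)) else None.

Lemma filter_deg_ub F a : F a -> lede (dg a) (filter_deg F).
Proof.
move=> Fa i; rewrite /filter_deg; case: pselect => // h.
by case: cid => b [/= + _]; apply.
Qed.

(** Each single coordinate of [n] is reached by some member. Directedness reaches all of them at
    once, and the resulting member is cut down to degree [n]. *)
Lemma filter_deg_seg F n : bfilter F -> lede n (filter_deg F) ->
  exists2 a, F a & dg a = n.
Proof.
move=> bF nF.
have [v Fv] := bf_ex bF.
have one i : exists2 a, F a & (n i <= dg a i)%N.
  have := nF i; rewrite /filter_deg; case: pselect => [h|h _].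
    by case: cid => b [/= _ [a Fa <-]]; exists a.
  elim: (n i) => [|N [a Fa Na]]; first by exists (idp v).
  move: Na; rewrite leq_eqVlt => /orP[/eqP ->|]; last by exists a.
  apply: contrapT => no; apply: h; exists (dg a i); split; last by exists a.
  move=> b Fb; rewrite leqNgt; apply/negP => lt; apply: no.
  by exists b.
have [a Fa na] : exists2 a, F a & led n (dg a).
  suff [a Fa h] : exists2 a, F a & forall i, i \in enum 'I_k -> (n i <= dg a i)%N.
    by exists a => // i; apply: h; rewrite mem_enum.
  elim: (enum 'I_k) => [|i s [a Fa h]]; first by exists (idp v).
  have [b Fb nb] := one i.
  have [c [d [ac bd e Fc]]] := bf_dir bF Fa Fb.
  exists (comp a c) => // j; rewrite inE => /orP[/eqP ->|/h nj].
    by rewrite e dg_comp// degDE (leq_trans nb)// leq_addr.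
  by rewrite dg_comp// degDE (leq_trans nj)// leq_addr.
have [b [c [<- bc e]]] := initial_segment na.
by exists b => //; apply: (bf_init bF bc); rewrite -e.
Qed.

(** [F] has a unique member of each degree [p] below [filter_deg F], and x(p, q) is the path leading
    from the member of degree [p] to that of degree [q]. The functor laws follow by left
    cancellation. *)
Lemma omega_path_bfilter F : bfilter F ->
  exists (m : edeg k) (x : omega_path Lam m), boundary_path x /\
    forall n, lede n m -> exists2 a, F a & pobj x n = src a.
Proof.
move=> bF; pose m := filter_deg F; have [v Fv] := bf_ex bF.
have [seg segP] : {seg : deg k -> mor Lam &
    forall n, lede n m -> F (seg n) /\ dg (seg n) = n}.
  suff /choice[f fP] : forall n, exists a, lede n m -> F a /\ dg a = n.
    by exists f.
  move=> n; have [nm|nm] := pselect (lede n m); last by exists (idp v).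
  by have [a Fa an] := filter_deg_seg bF nm; exists a.
have segI a n : F a -> dg a = n -> seg n = a.
  move=> Fa an; have [|Fs ds] := segP n; first by rewrite -an; exact: filter_deg_ub.
  by apply: (bf_uniq bF) => //; rewrite ds.
have [f fP] : {f : deg k -> deg k -> mor Lam & forall p q, led p q -> lede q m ->
    src (seg p) = rng (f p q) /\ seg q = comp (seg p) (f p q)}.
  suff /choice[f fP] : forall pq : deg k * deg k, exists b,
      led pq.1 pq.2 -> lede pq.2 m ->
      src (seg pq.1) = rng b /\ seg pq.2 = comp (seg pq.1) b.
    by exists (fun p q => f (p, q)) => p q; exact: (fP (p, q)).
  move=> [p q] /=; have [[pq qm]|h] := pselect (led p q /\ lede q m); last first.
    by exists (idp v) => pq qm; case: h.
  have [Fq dq] := segP _ qm.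
  have pq' : led p (dg (seg q)) by rewrite dq.
  have [a [b [da ab e]]] := initial_segment pq'.
  have -> : seg p = a by apply: segI => //; apply: (bf_init bF ab); rewrite -e.
  by exists b.
have dgf p q : led p q -> lede q m -> p + dg (f p q) = q.
  move=> pq qm; have [pf sq] := fP _ _ pq qm.
  rewrite -[RHS](segP q qm).2 sq dg_comp//; congr (_ + _).
  by rewrite (segP p (lede_led pq qm)).2.
have ledxx (p : deg k) : led p p by move=> i.
have f_rng p q : led p q -> lede q m -> rng (f p q) = src (seg p).
  by move=> pq qm; have [-> _] := fP p q pq qm.
have f_src p q : led p q -> lede q m -> src (f p q) = src (seg q).
  by move=> pq qm; have [h ->] := fP p q pq qm; rewrite src_comp.
have f_id p : lede p m -> f p p = idp (src (seg p)).
  move=> pm; have [h e] := fP p p (ledxx p) pm.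
  apply: (@compI _ _ (seg p)) => //; first by rewrite rng_idp.
  by rewrite -e comp_idr.
have f_comp p q r : led p q -> led q r -> lede r m ->
    f p r = comp (f p q) (f q r).
  move=> pq qr rm.
  have pr : led p r by move=> i; apply: leq_trans (pq i) (qr i).
  have qm := lede_led qr rm.
  have [h1 e1] := fP _ _ pq qm; have [h2 e2] := fP _ _ qr rm.
  have [h3 e3] := fP _ _ pr rm.
  have h4 : src (f p q) = rng (f q r) by rewrite -h2 e1 src_comp.
  apply: (@compI _ _ (seg p)) => //; first by rewrite rng_comp.
  by rewrite -e3 e2 e1 compA.
exists m, (OmegaPath f_rng f_src f_id f_comp dgf); split=> [p pm E FEE|n nm]; last first.
  by exists (seg n) => //; exact: (segP n nm).1.
have [Fp dp] := segP _ pm.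
have [mu Emu Fmu] := bf_bd bF Fp FEE.
have [_ [/(_ _ Emu) rmu _] _] := FEE.
have dE : dg (comp (seg p) mu) = p + dg mu by rewrite dg_comp// dp.
have lm : lede (p + dg mu) m by rewrite -dE; exact: filter_deg_ub.
exists mu => //; split=> //=.
have [h e] := fP p (p + dg mu) (@led_addr _ _ _) lm.
by apply: (@compI _ _ (seg p)) => //; rewrite -e; exact: segI.
Qed.

End BoundaryPaths.

(** * Construction of boundary paths that avoid a saturated hereditary set *)

Section Existence.
Context {k : nat} (Lam : kgraph k) (fa : finitely_aligned Lam).
Implicit Types (v w : vtx Lam) (lam mu nu : mor Lam) (E F : set (mor Lam)).

(** A task [t] is a path with a list that may enumerate a finite exhaustive set at its source. If
    every path of the transported set led into [H], saturation would put [src lam] in [H]; so [lam]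
    has an extension that avoids [H] and passes through the exhaustive set. A task that does not
    apply leaves [lam] unchanged. *)
Lemma avoiding_step (H : set (vtx Lam)) lam (t : mor Lam * seq (mor Lam)) :
  saturated H -> ~ H (src lam) -> exists lam',
  [/\ ~ H (src lam'), exists2 a, src lam = rng a & lam' = comp lam a &
    forall nu, src t.1 = rng nu -> lam = comp t.1 nu ->
      FE (src t.1) [set` t.2] -> exists mu b,
      [/\ mu \in t.2, src t.1 = rng mu, src mu = rng b &
        lam' = comp (comp t.1 mu) b]].
Proof.
case: t => rho s satH nH /=.
have [[nu [rn e FEs]]|h] := pselect (exists nu, [/\ src rho = rng nu,
    lam = comp rho nu & FE (src rho) [set` s]]); last first.
  exists lam; split=> //; first by exists (idp (src lam)); rewrite ?rng_idp ?comp_idr.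
  by move=> nu rn e FEs; case: h; exists nu.
have [fs exs _] := FEs.
have ln : src lam = src nu by rewrite e src_comp.
have exE : exhaustive (src lam) (Ext nu [set` s]).
  by rewrite ln; apply: exhaustive_Ext; rewrite -rn.
have [g Eg nHg] : exists2 g, Ext nu [set` s] g & ~ H (src g).
  (* A transported set containing the vertex is not in [FE], but then the trivial extension
     works. *)
  have [idE|nidE] := pselect (Ext nu [set` s] (idp (src lam))).
    by exists (idp (src lam)); rewrite ?src_idp.
  apply: contrapT => no; apply: nH; apply: (satH _ (Ext nu [set` s])).
    by split=> //; exact: finite_Ext.
  move=> w [g Eg <-]; apply: contrapT => nHg; apply: no.
  by exists g.
have [mu [b [smu ng mub e']]] := Ext_extends Eg.
have lg : src lam = rng g by rewrite ln.
have rm : src rho = rng mu by rewrite rn -(rng_comp ng) e' rng_comp.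
exists (comp lam g); split; first by rewrite src_comp.
  by exists g.
move=> nu' rn' e2 _; exists mu, b; split=> //.
by rewrite -compA// -e' compA// -e.
Qed.

(* Every pair (path, candidate exhaustive set) is dealt with at infinitely many
   stages, hence at one where the path has become an initial segment. *)
Lemma avoiding_bfilter (H : set (vtx Lam)) v : hereditary H -> saturated H ->
  ~ H v -> exists F, [/\ bfilter F, F (idp v) & forall a, F a -> ~ H (src a)].
Proof.
move=> herH satH nHv.
pose task := (mor Lam * seq (mor Lam))%type.
pose P lam (t : task) lam' := ~ H (src lam) ->
  [/\ ~ H (src lam'), exists2 a, src lam = rng a & lam' = comp lam a &
    forall nu, src t.1 = rng nu -> lam = comp t.1 nu ->
      FE (src t.1) [set` t.2] -> exists mu b,
      [/\ mu \in t.2, src t.1 = rng mu, src mu = rng b &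
        lam' = comp (comp t.1 mu) b]].
have [next nextP] : {next : mor Lam -> task -> mor Lam &
    forall lam t, P lam t (next lam t)}.
  suff /choice[f fP] : forall p : mor Lam * task, exists lam', P p.1 p.2 lam'.
    by exists (fun lam t => f (lam, t)) => lam t; exact: (fP (lam, t)).
  move=> [lam t]; have [Hl|Hl] := pselect (H (src lam)); first by exists lam.
  by have [lam' ?] := avoiding_step t satH Hl; exists lam'.
(* The second component of the decoded pair is discarded, so a task recurs once for each natural
   number. Numbers that are no codes give a dummy task. *)
pose tk (n : nat) : task := if unpickle n is Some p then
  (p : task * nat).1 else (idp v, [::]).
pose fix path n := if n is n'.+1 then next (path n') (tk n') else idp v.
have pathH n : ~ H (src (path n)).
  elim: n => [|n IH] /=; first by rewrite src_idp.
  by have [] := nextP _ (tk n) IH.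
have pathS n : exists2 a, src (path n) = rng a & path n.+1 = comp (path n) a.
  by have [] := nextP _ (tk n) (pathH n).
have pathD n j : exists2 a, src (path n) = rng a & path (n + j)%N = comp (path n) a.
  elim: j => [|j [a ha e]].
    by exists (idp (src (path n))); rewrite ?rng_idp// addn0 comp_idr.
  have [b hb e'] := pathS (n + j)%N.
  have ab : src a = rng b by rewrite -hb e src_comp.
  by exists (comp a b); rewrite ?rng_comp// addnS e' e compA.
pose F : set (mor Lam) := [set a | exists n b, src a = rng b /\ path n = comp a b].
have Fext a n b : src a = rng b -> path n = comp a b -> forall j,
    exists2 c, src a = rng c & path (n + j)%N = comp a c.
  move=> ab e j; have [c hc e'] := pathD n j.
  have bc : src b = rng c by rewrite -hc e src_comp.
  by exists (comp b c); rewrite ?rng_comp// e' e compA.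
have Fpath n : F (path n).
  by exists n, (idp (src (path n))); rewrite rng_idp comp_idr.
exists F; split; last first.
- move=> a [n [b [ab e]]] Ha; apply: (pathH n).
  by rewrite e src_comp//; apply: herH; rewrite -ab.
- exact: (Fpath 0%N).
split.
- by exists v; exact: (Fpath 0%N).
- move=> a b ab [n [c [hc e]]]; rewrite src_comp// in hc.
  by exists n, (comp b c); rewrite rng_comp// compA.
- move=> a b [n [c [ac e]]] [n' [d [bd e']]].
  have [c' hc ec] := Fext _ _ _ ac e n'.
  have [d' hd ed] := Fext _ _ _ bd e' n.
  exists c', d'; split=> //; first by rewrite -ec -ed addnC.
  by rewrite -ec; exact: Fpath.
- move=> a E [n [b [ab e]]] FEE; have [s us sE] := FE_seq FEE.
  pose N (i : nat) := pickle ((a, s) : task, i).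
  have tkN i : tk (N i) = (a, s) by rewrite /tk /N pickleK.
  (* The codes [N i] are distinct, so they cannot all lie below [n]. *)
  have [i ni] : exists i, (n <= N i)%N.
    have injN : injective N by move=> i j /(pcan_inj pickleK)[].
    apply: contrapT => no.
    have lt i : (N i < n)%N by rewrite ltnNge; apply/negP => le; apply: no; exists i.
    have injO : injective (fun i : 'I_n.+1 => Ordinal (lt i)).
      by move=> i j [] /injN /val_inj.
    by have := leq_card _ injO; rewrite !card_ord ltnn.
  have [c ac e'] := Fext _ _ _ ab e (N i - n)%N.
  rewrite subnKC// in e'.
  have [_ _ /=] := nextP _ (a, s) (pathH (N i)).
  move=> /(_ c ac e').
  rewrite sE => /(_ FEE)[mu [d [smu am md E']]].
  exists mu; first by rewrite -sE.
  exists (N i).+1, d; split; first by rewrite src_comp.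
  by rewrite -E' -(tkN i).
Qed.

(** The empty set is saturated, because exhaustive sets are nonempty; the construction avoiding it
    can start at any vertex. *)
Lemma bfilter_exists v : exists2 F : set (mor Lam), bfilter F & F (idp v).
Proof.
have [||//|F [bF Fv _]] := @avoiding_bfilter set0 v; last by exists F.
- by [].
- move=> w E [_ [_ exE] _] sub.
  have [|mu Emu _] := exE (idp w); first exact: rng_idp.
  by apply: (sub (src mu)); exists mu.
Qed.

End Existence.

(** * Representations *)

Section Endomorphisms.
Context (R : comNzRingType) (V : lmodType R).

(** Linear maps are carved out of the function module, so that [endo] inherits its module
    structure. *)
Definition is_linear : {pred V -> V} := fun f => `[< linear f >].

Lemma is_linear_submod_closed : submod_closed is_linear.
Proof.
split=> [|a f g /asboolP lf /asboolP lg]; apply/asboolP => b x y.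
  by rewrite /= scaler0 addr0.
change (a *: f (b *: x + y) + g (b *: x + y) =
  b *: (a *: f x + g x) + (a *: f y + g y)).
rewrite lf lg !scalerDr !scalerA -!addrA [b * a]mulrC; congr (_ + _).
exact: addrCA.
Qed.
HB.instance Definition _ :=
  GRing.isSubmodClosed.Build R (V -> V) is_linear is_linear_submod_closed.

Definition endo := {f : V -> V | f \in is_linear}.
HB.instance Definition _ := Choice.on endo.
HB.instance Definition _ := SubChoice.on endo.
HB.instance Definition _ := [SubChoice_isSubLmodule of endo by <:].

Lemma endoP (f : endo) : linear (val f).
Proof. by apply/asboolP; exact: (valP f). Qed.

Lemma endoD (f : endo) x y : val f (x + y) = val f x + val f y.
Proof. by rewrite -[x]scale1r endoP !scale1r. Qed.

Lemma endo0 (f : endo) : val f 0 = 0.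
Proof. by apply: (addIr (val f 0)); rewrite -endoD !add0r. Qed.

Lemma endoZ (f : endo) a x : val f (a *: x) = a *: val f x.
Proof. by have := endoP f a x 0; rewrite endo0 !addr0. Qed.

Lemma endo_mul_subproof (f g : endo) : val f \o val g \in is_linear.
Proof. by apply/asboolP => a x y /=; rewrite !endoP. Qed.

Definition endo_mul (f g : endo) : endo := 
  exist (fun h => h \in is_linear) (val f \o val g) (endo_mul_subproof f g).

Lemma endo_ext (f g : endo) : (forall x, val f x = val g x) -> f = g.
Proof. by move=> h; apply/val_inj/funext. Qed.

Lemma endo_addE (f g : endo) x : val (f + g) x = val f x + val g x.
Proof. by []. Qed.

Lemma endo_scaleE a (f : endo) x : val (a *: f) x = a *: val f x.
Proof. by []. Qed.

Lemma endo_sumE (I : Type) (s : seq I) (F : I -> endo) x :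
  val (\sum_(i <- s) F i) x = \sum_(i <- s) val (F i) x.
Proof.
elim: s => [|i s IH]; first by rewrite !big_nil.
by rewrite !big_cons endo_addE IH.
Qed.

Lemma endo_mulA : associative endo_mul.
Proof. by move=> f g h; exact: endo_ext. Qed.

Lemma endo_mulDl : left_distributive endo_mul +%R.
Proof. by move=> f g h; exact: endo_ext. Qed.

Lemma endo_mulDr : right_distributive endo_mul +%R.
Proof. by move=> f g h; apply: endo_ext => x; exact: endoD. Qed.

Lemma endo_mulZl (a : R) (f g : endo) : endo_mul (a *: f) g = a *: endo_mul f g.
Proof. exact: endo_ext. Qed.

Lemma endo_mulZr (a : R) (f g : endo) : endo_mul f (a *: g) = a *: endo_mul f g.
Proof. by apply: endo_ext => x; exact: endoZ. Qed.

Definition End : nualg R :=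
  NuAlg endo_mulA endo_mulDl endo_mulDr endo_mulZl endo_mulZr.

End Endomorphisms.

Arguments is_linear {R V}.

(** A single list serves all summands, so that sums over the same set can be compared term by
    term. *)
Lemma fsbig_seqE (T : choiceType) (A : set T) : finite_set A ->
  exists s : seq T, [/\ uniq s, forall x, x \in s <-> A x &
    forall (V : nmodType) (F : T -> V), \sum_(i \in A) F i = \sum_(i <- s) F i].
Proof.
move=> fA; exists (finmap.enum_fset (fset_set A)); split.
- exact: finmap.fset_uniq.
- move=> x; have := in_fset_set fA x; rewrite unfold_in/= => ->.
  by split=> [/set_mem|/mem_set].
- by move=> V F; rewrite fsbig_finite.
Qed.

(** Turns the left fold of [nuprod], which has no unit to start from, into a right fold that acts on
    [y]. *)
Lemma foldl_numul (R : comNzRingType) (A : nualg R) (x y : A) (l : seq A) :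
  foldl (@numul R A) x l ** y = x ** foldr (@numul R A) y l.
Proof. by elim: l x => //= z l IH x; rewrite IH numulA. Qed.

Lemma foldl_endo_mul (R : comNzRingType) (V : lmodType R) (g : endo V)
    (l : seq (endo V)) x :
  val (foldl (@endo_mul R V) g l) x = val g (foldr (fun h y => val h y) x l).
Proof. by elim: l g => //= h l IH g; rewrite IH. Qed.

(** * The boundary path representation on a shift-invariant set of filters *)

Section BoundaryRepresentation.
Context {k : nat} (Lam : kgraph k) (fa : finitely_aligned Lam).
Context (R : comNzRingType) (B : set (set (mor Lam))).
Hypothesis B_bfilter : forall F, B F -> bfilter F.
Hypothesis B_tailf : forall F lam, B F -> F lam -> B (tailf lam F).
Hypothesis B_consf : forall F lam, B F -> F (idp (src lam)) -> B (consf lam F).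

(** There is no support condition, so that constant functions are available. *)
Definition bspace : lmodType R := set (mor Lam) -> R^o.

Implicit Types (f g : bspace) (lam mu nu : mor Lam).

(** For y in [B] starting at [src lam], the indicator function of y goes to that of y with [lam]
    prepended; [bt_fun lam] goes back. *)
Definition bs_fun lam f : bspace :=
  fun F => if `[< B F /\ F lam >] then f (tailf lam F) else 0.

Definition bt_fun lam f : bspace :=
  fun F => if `[< B F /\ F (idp (src lam)) >] then f (consf lam F) else 0.

Lemma bs_subproof lam : bs_fun lam \in is_linear.
Proof.
apply/asboolP => a f g; apply/funext => F.
change (bs_fun lam (a *: f + g) F = a *: bs_fun lam f F + bs_fun lam g F).
by rewrite /bs_fun; case: ifP => // _; rewrite scaler0 addr0.
Qed.

Lemma bt_subproof lam : bt_fun lam \in is_linear.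
Proof.
apply/asboolP => a f g; apply/funext => F.
change (bt_fun lam (a *: f + g) F = a *: bt_fun lam f F + bt_fun lam g F).
by rewrite /bt_fun; case: ifP => // _; rewrite scaler0 addr0.
Qed.

Definition bs lam : End bspace :=
  exist (fun h => h \in is_linear) (bs_fun lam) (bs_subproof lam).
Definition bt lam : End bspace :=
  exist (fun h => h \in is_linear) (bt_fun lam) (bt_subproof lam).

Lemma bsE lam f F : B F -> F lam -> bs_fun lam f F = f (tailf lam F).
Proof. by move=> BF Fl; rewrite /bs_fun asboolT. Qed.

Lemma bs0 lam f F : ~ (B F /\ F lam) -> bs_fun lam f F = 0.
Proof. by move=> h; rewrite /bs_fun asboolF. Qed.

Lemma btE lam f F : B F -> F (idp (src lam)) -> bt_fun lam f F = f (consf lam F).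
Proof. by move=> BF Fl; rewrite /bt_fun asboolT. Qed.

Lemma bt0 lam f F : ~ (B F /\ F (idp (src lam))) -> bt_fun lam f F = 0.
Proof. by move=> h; rewrite /bt_fun asboolF. Qed.

Lemma tailf_mem_idp lam F : F lam -> tailf lam F (idp (src lam)).
Proof. by move=> Fl; split; rewrite ?rng_idp// comp_idr. Qed.

Lemma bs_bt lam f F : bs_fun lam (bt_fun lam f) F = if `[< B F /\ F lam >] then f F else 0.
Proof.
case: asboolP => [[BF Fl]|h]; last exact: bs0.
rewrite bsE// btE ?consf_tailf//; [exact: B_bfilter|exact: B_tailf|].
exact: tailf_mem_idp.
Qed.

Lemma bs_idp v f F : bs_fun (idp v) f F = if `[< B F /\ F (idp v) >] then f F else 0.
Proof.
case: asboolP => [[BF Fl]|h]; last exact: bs0.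
by rewrite bsE// tailf_idp//; exact: B_bfilter.
Qed.

Lemma boundary_kp_family : kp_family bs bt.
Proof.
split=> [v|v w|mu nu h|mu nu|v E EF s us sE].
- apply: endo_ext => f; apply/funext => F /=.
  rewrite bs_idp /bt_fun src_idp; case: asboolP => // -[BF Fv].
  have bF := B_bfilter BF.
  by rewrite -{1}(tailf_idp bF Fv) consf_tailf.
- apply: endo_ext => f; apply/funext => F.
  change (bs_fun (idp v) (bs_fun (idp w) f) F =
    (val (if v == w then bs (idp v) else 0) f) F).
  rewrite bs_idp; case: eqP => [<-/=|vw].
    by rewrite bs_idp; case: asboolP.
  case: asboolP => // -[BF Fv]; rewrite bs0// => -[_ Fw]; apply: vw.
  by have := bf_rng (B_bfilter BF) Fv Fw; rewrite !rng_idp.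
- split; apply: endo_ext => f; apply/funext => F.
    change (bs_fun mu (bs_fun nu f) F = bs_fun (comp mu nu) f F).
    have [[BF Fmn]|no] := pselect (B F /\ F (comp mu nu)).
      have Fm : F mu by apply: (bf_init (B_bfilter BF) h).
      rewrite [RHS]bsE// bsE// bsE ?tailf_comp//.
      exact: B_tailf.
    rewrite [RHS]bs0//; have [[BF Fm]|no'] := pselect (B F /\ F mu).
      by rewrite bsE// bs0// => -[_ [_ Fn]]; apply: no.
    by rewrite bs0.
  change (bt_fun nu (bt_fun mu f) F = bt_fun (comp mu nu) f F).
  have [[BF Fn]|no] := pselect (B F /\ F (idp (src nu))); last first.
    by rewrite bt0// bt0// src_comp.
  rewrite [RHS]btE ?src_comp// btE// btE ?consf_comp//.
  + exact: B_bfilter.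
  + exact: B_consf.
  + by rewrite h; apply/consf_rng => //; exact: B_bfilter.
- have [s [us sP ->]] := fsbig_seqE (fa mu nu).
  apply: endo_ext => f; apply/funext => F.
  rewrite (endo_sumE s) fct_sumE.
  change (bt_fun mu (bs_fun nu f) F =
    \sum_(p <- s) bs_fun p.1 (bt_fun p.2 f) F).
  have [BF|nB] := pselect (B F); last first.
    by rewrite bt0 ?big1// => [p _|[]//]; rewrite bs0// => -[].
  have bF := B_bfilter BF.
  (* All [p.1] have the same degree, so at most one of them is a segment of [F], and the sum has at
     most one nonzero term. If there is none, the left side vanishes too, by [min_ext]. *)
  have [[p sp Fp]|no] := pselect (exists2 p, p \in s & F p.1); last first.
    rewrite big1_seq => [|p /= sp]; last first.
      by rewrite bs0// => -[_ Fp]; apply: no; exists p.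
    have [Fm|nFm] := pselect (F (idp (src mu))); last by rewrite bt0// => -[].
    rewrite btE// bs0// => -[_ [nu' [b [h Fn' hb e]]]].
    have [p [d [hp s1 s2 e1 e2]]] := min_ext h hb (esym e).
    apply: no; exists p; first exact/sP.
    by apply: (bf_init bF s1); rewrite -e1.
  have /sP hp := sp; have [h1 h2 e _] := hp.
  rewrite (bigD1_seq p)//= big1_seq => [|q /andP[qp /sP hq]]; last first.
    rewrite bs0// => -[_ Fq]; move/eqP: qp; apply; apply: (Lmin_inj hq hp).
    by apply: (bf_uniq bF) => //; exact: Lmin_dg1 hq hp.
  rewrite addr0; have Fm : F (idp (src mu)) by rewrite h1; exact: bf_idp Fp.
  have sp12 := Lmin_src hp.
  have Bt := B_tailf BF Fp; have bt' := B_bfilter Bt.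
  have tid : tailf p.1 F (idp (src p.2)) by rewrite -sp12; exact: tailf_mem_idp.
  have Bc := B_consf Bt tid; have bc := B_bfilter Bc.
  have cid : consf p.2 (tailf p.1 F) (idp (src nu)) by rewrite h2; apply/consf_rng.
  (* With F' the tail of [F] along [p.1], both sides prepend the common extension of [mu] and [nu]
     to F'. *)
  have cE : consf mu F = consf nu (consf p.2 (tailf p.1 F)).
    rewrite -{1}(consf_tailf bF Fp) -!consf_comp ?e//.
    by rewrite sp12.
  rewrite btE// bsE//; last 2 first.
  + exact: B_consf.
  + rewrite cE -[X in consf _ _ X]comp_idr.
    by apply: consf_sub; rewrite ?rng_idp.
  by rewrite bsE// btE// cE tailf_consf.
- apply: endo_ext => f; apply/funext => F; change ((val (nuprod
    [seq bs (idp v) - bs mu ** bt mu | mu <- s]) f) F = 0).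
  case: s us sE => [_ s0|mu0 s0 _].
    have [_ [_ ex] _] := EF; have [|x] := ex (idp v); first exact: rng_idp.
    by rewrite -s0.
  set s := mu0 :: s0 => sE.
  rewrite [X in val X]/= foldl_endo_mul -[val _ _]/(foldr (fun h y => val h y) f
     [seq bs (idp v) - bs mu ** bt mu | mu <- s]).
  (* Each factor multiplies the value at [F] by a scalar, so it suffices that one factor vanishes
     there. Either [F] does not start at [v], and every factor does, or the boundary condition
     provides a [mu] in [E] that begins [F]. *)
  have [mu ms Fmu] : exists2 mu, mu \in s & ~ (B F /\ F (idp v)) \/ F mu.
    have [[BF Fv]|no] := pselect (B F /\ F (idp v)); last first.
      by exists mu0; [rewrite mem_head|left].
    have [|mu Emu Fmu] := bf_bd (B_bfilter BF) (E := E) Fv; first by rewrite src_idp.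
    have [_ [/(_ _ Emu) rm _] _] := EF.
    exists mu; first by rewrite -sE in Emu.
    by right; rewrite comp_id_l in Fmu.
  have rv nu : nu \in s -> rng nu = v.
    by have [_ [rE _] _] := EF => ns; apply: rE; rewrite -sE.
  elim: s {sE} ms rv => // nu s IH; rewrite inE /= => mns rv.
  set y := foldr _ _ _.
  change (bs_fun (idp v) y F - bs_fun nu (bt_fun nu y) F = 0).
  rewrite bs_idp bs_bt.
  case/orP: mns => [/eqP mE|ms]; last first.
    have -> : y F = 0 by apply: IH => // n' ns; apply: rv; rewrite inE ns orbT.
    by rewrite !if_same subrr.
  subst nu; have rm : rng mu = v by apply: rv; rewrite mem_head.
  case: asboolP => h1; case: asboolP => h2; rewrite ?subrr ?subr0//.
    by case: Fmu => // Fmu; case: h2; split=> //; case: h1.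
  case: h1; case: h2 => BF Fm; split=> //; rewrite -rm.
  exact: bf_idp (B_bfilter BF) Fm.
Qed.

End BoundaryRepresentation.

(** * Kumjian-Pask families *)

Section NuAlgebra.
Context {R : comNzRingType} (A : nualg R).
Implicit Types (x y : A) (J : set R) (X : set A).

Lemma numul0r x : (0 : A) ** x = 0.
Proof. by apply: (addIr (0 ** x)); rewrite -numulDl !add0r. Qed.

Lemma numulr0 x : x ** (0 : A) = 0.
Proof. by apply: (addIr (x ** 0)); rewrite -numulDr !add0r. Qed.

Lemma numulNr x y : (- x) ** y = - (x ** y).
Proof. by apply: (addIr (x ** y)); rewrite -numulDl !addNr numul0r. Qed.

Lemma numulrN x y : x ** (- y) = - (x ** y).
Proof. by apply: (addIr (x ** y)); rewrite -numulDr !addNr numulr0. Qed.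

Lemma numul_suml (I : Type) (s : seq I) (F : I -> A) y :
  (\sum_(i <- s) F i) ** y = \sum_(i <- s) F i ** y.
Proof.
by elim: s => [|i s IH]; rewrite ?big_nil ?numul0r// !big_cons numulDl IH.
Qed.

Lemma numul_sumr (I : Type) (s : seq I) (F : I -> A) y :
  y ** (\sum_(i <- s) F i) = \sum_(i <- s) y ** F i.
Proof.
by elim: s => [|i s IH]; rewrite ?big_nil ?numulr0// !big_cons numulDr IH.
Qed.

Lemma lincomb0 J X : lincomb J X 0.
Proof. by exists [::]; rewrite ?big_nil. Qed.

Lemma lincombD J X x y : lincomb J X x -> lincomb J X y -> lincomb J X (x + y).
Proof.
move=> [s hs ->] [t ht ->]; exists (s ++ t); last by rewrite big_cat.
by move=> p; rewrite mem_cat => /orP[/hs|/ht].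
Qed.

Lemma lincomb_gen J X a x : J a -> X x -> lincomb J X (a *: x).
Proof.
move=> Ja Xx; exists [:: (a, x)]; last by rewrite big_seq1.
by move=> p; rewrite inE => /eqP ->.
Qed.

Lemma lincomb_ind J X (P : A -> Prop) : P 0 -> (forall x y, P x -> P y -> P (x + y)) ->
  (forall a x, J a -> X x -> P (a *: x)) -> forall x, lincomb J X x -> P x.
Proof.
move=> P0 PD PX x [s + ->]; elim: s => [|p s IH] h; first by rewrite big_nil.
rewrite big_cons; apply: PD; last by apply: IH => q qs; apply: h; rewrite inE qs orbT.
by apply: PX; case: (h p) => //; rewrite inE eqxx.
Qed.

Lemma lincombZ X c x : lincomb setT X x -> lincomb setT X (c *: x).
Proof.
elim/lincomb_ind: x / => [|x y hx hy|a x _ Xx].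
- by rewrite scaler0; exact: lincomb0.
- by rewrite scalerDr; exact: lincombD.
- by rewrite scalerA; exact: lincomb_gen.
Qed.

Lemma nuideal_lincomb J : rideal J -> nuideal (lincomb J [set: A]).
Proof.
move=> [J0 JD JM]; split.
- exact: lincomb0.
- exact: lincombD.
- move=> c x; elim/lincomb_ind: x / => [|x y hx hy|a x Ja _].
  + by rewrite scaler0; exact: lincomb0.
  + by rewrite scalerDr; exact: lincombD.
  + by rewrite scalerA; apply: lincomb_gen => //; exact: JM.
- move=> x y; elim/lincomb_ind: x / => [|x z [hx hx'] [hz hz']|a x Ja _].
  + by rewrite numul0r numulr0; split; exact: lincomb0.
  + by rewrite numulDl numulDr; split; exact: lincombD.
  + by rewrite numulZl numulZr; split; exact: lincomb_gen.
Qed.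

Section Ideal.
Variables (I : set A) (hI : nuideal I).

Lemma nuideal0 : I 0. Proof. by case: hI. Qed.

Lemma nuidealD x y : I x -> I y -> I (x + y).
Proof. by case: hI => _ + _ _; apply. Qed.

Lemma nuidealZ a x : I x -> I (a *: x).
Proof. by case: hI => _ _ + _; apply. Qed.

Lemma nuidealN x : I x -> I (- x).
Proof. by rewrite -scaleN1r; exact: nuidealZ. Qed.

Lemma nuidealB x y : I x -> I y -> I (x - y).
Proof. by move=> hx hy; apply: nuidealD => //; exact: nuidealN. Qed.

Lemma nuidealMr x y : I x -> I (x ** y).
Proof. by case: hI => _ _ _ h Ix; case: (h x y Ix). Qed.

Lemma nuidealMl x y : I x -> I (y ** x).
Proof. by case: hI => _ _ _ h Ix; case: (h x y Ix). Qed.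

Lemma nuideal_sum (T : eqType) (s : seq T) (F : T -> A) :
  (forall i, i \in s -> I (F i)) -> I (\sum_(i <- s) F i).
Proof.
elim: s => [|i s IH] h; first by rewrite big_nil; exact: nuideal0.
rewrite big_cons; apply: nuidealD; first by apply: h; rewrite mem_head.
by apply: IH => j js; apply: h; rewrite inE js orbT.
Qed.

End Ideal.

End NuAlgebra.

(** * Relations and range projections in a Kumjian-Pask family *)

Section Family.
Context {k : nat} (Lam : kgraph k) (fa : finitely_aligned Lam).
Context (R : comNzRingType) (A : nualg R) (S T : mor Lam -> A).
Hypothesis fam : kp_family S T.
Implicit Types (v w : vtx Lam) (lam mu nu : mor Lam) (x y : A).

Lemma kp_SS mu nu : src mu = rng nu -> S mu ** S nu = S (comp mu nu).
Proof. by move=> h; case: (kp2 fam h). Qed.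

Lemma kp_TT mu nu : src mu = rng nu -> T nu ** T mu = T (comp mu nu).
Proof. by move=> h; case: (kp2 fam h). Qed.

Lemma kp_idS mu : S (idp (rng mu)) ** S mu = S mu.
Proof. by rewrite kp_SS ?src_idp// comp_idl. Qed.

Lemma kp_Sid mu : S mu ** S (idp (src mu)) = S mu.
Proof. by rewrite kp_SS ?rng_idp// comp_idr. Qed.

Lemma kp_idT mu : S (idp (src mu)) ** T mu = T mu.
Proof. by rewrite -(kp_ghost_vtx fam) kp_TT ?rng_idp// comp_idr. Qed.

Lemma kp_Tid mu : T mu ** S (idp (rng mu)) = T mu.
Proof. by rewrite -(kp_ghost_vtx fam) kp_TT ?src_idp// comp_idl. Qed.

Lemma kp_TS_eqdg mu nu : dg mu = dg nu ->
  T mu ** S nu = if mu == nu then S (idp (src mu)) else 0.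
Proof.
move=> h; rewrite (kp3 fam); case: eqP => [<-|ne].
  by rewrite Lmin_diag fsbig_set1/= (kp_ghost_vtx fam) (kp1 fam) eqxx.
by rewrite (Lmin_eqdg h ne) fsbig_set0.
Qed.

Lemma kp_TS mu : T mu ** S mu = S (idp (src mu)).
Proof. by rewrite kp_TS_eqdg// eqxx. Qed.

Lemma kp_TS_ext mu nu : src mu = rng nu -> T (comp mu nu) ** S mu = T nu.
Proof. by move=> h; rewrite -kp_TT// -numulA kp_TS h kp_Tid. Qed.

Lemma kp_TS0 mu nu : Lmin mu nu = set0 -> T mu ** S nu = 0.
Proof. by move=> h; rewrite (kp3 fam) h fsbig_set0. Qed.

(** By (KP3) both products are the sum of the range projections of the minimal common extensions,
    which is symmetric in [mu] and [nu]. *)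
Lemma kp_proj_comm mu nu :
  (S mu ** T mu) ** (S nu ** T nu) = (S nu ** T nu) ** (S mu ** T mu).
Proof.
have [s [us sP sE]] := fsbig_seqE (fa mu nu).
have projE a b : (S a ** T a) ** (S b ** T b) =
    \sum_(p \in Lmin a b) S (comp a p.1) ** T (comp b p.2).
  have [t [_ tP tE]] := fsbig_seqE (fa a b).
  rewrite numulA -[S a ** T a ** S b]numulA (kp3 fam) !tE numul_sumr numul_suml.
  apply: eq_big_seq => p /tP [h1 h2 _ _].
  by rewrite numulA -numulA kp_TT// kp_SS.
rewrite !projE sE.
have [t [ut tP ->]] := fsbig_seqE (fa nu mu).
have -> : \sum_(p <- t) S (comp nu p.1) ** T (comp mu p.2) =
    \sum_(p <- [seq (q.2, q.1) | q <- s]) S (comp nu p.1) ** T (comp mu p.2).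
  apply: perm_big; apply: uniq_perm => //.
    by rewrite map_inj_uniq// => -[? ?] [? ?] [-> ->].
  move=> [a b]; apply/idP/mapP => [/tP/Lmin_sym/sP h|[[a' b'] /sP/Lmin_sym h [-> ->]]].
    by exists (b, a).
  exact/tP.
rewrite big_map; apply: eq_big_seq => p /sP [h1 h2 e _] /=.
by rewrite e.
Qed.

(* Left multiplication by the product of the projections 1 - S_a T_a, a in s;
   the unit 1 does not exist in A. *)
Definition cutoff (s : seq (mor Lam)) x : A :=
  foldr (fun a y => y - S a ** (T a ** y)) x s.

Lemma cutoffD s x y : cutoff s (x + y) = cutoff s x + cutoff s y.
Proof.
by elim: s => //= a s ->; rewrite !numulDr opprD addrACA.
Qed.

Lemma cutoffZ s c x : cutoff s (c *: x) = c *: cutoff s x.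
Proof. by elim: s => //= a s ->; rewrite !numulZr -scalerBr. Qed.

Lemma cutoff0 s : cutoff s 0 = 0.
Proof. by rewrite -[X in cutoff s X](scale0r 0) cutoffZ scale0r. Qed.

Lemma cutoff_sum (I : Type) (r : seq I) (F : I -> A) s :
  cutoff s (\sum_(i <- r) F i) = \sum_(i <- r) cutoff s (F i).
Proof.
elim: r => [|i r IH]; first by rewrite !big_nil cutoff0.
by rewrite !big_cons cutoffD IH.
Qed.

Lemma cutoffM s x y : cutoff s (x ** y) = cutoff s x ** y.
Proof. by elim: s => //= a s ->; rewrite numulDl numulNr !numulA. Qed.

Lemma proj_cutoff s a x :
  S a ** (T a ** cutoff s x) = cutoff s (S a ** (T a ** x)).
Proof.
elim: s => //= b s IH; rewrite -IH !numulDr !numulrN; congr (_ - _).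
have := congr1 (fun z => z ** cutoff s x) (kp_proj_comm a b).
by rewrite /= !numulA.
Qed.

Lemma cutoff_mem s a : a \in s -> cutoff s (S a) = 0.
Proof.
elim: s => //= b s IH; rewrite inE => /orP[/eqP <-|/IH ->].
  by rewrite proj_cutoff kp_TS kp_Sid subrr.
by rewrite !numulr0 subrr.
Qed.

(** On elements fixed by [S (idp w)] the factors 1 - S_a T_a and S_w - S_a T_a act alike, so this is
    (KP4) applied to [y]. When [s] contains the vertex, which (KP4) excludes, that factor kills
    [S (idp w)]. *)
Lemma cutoff_exhaustive s w y : uniq s -> exhaustive w [set` s] ->
  S (idp w) ** y = y -> cutoff s y = 0.
Proof.
move=> us exs wy; have [ws|nws] := boolP (idp w \in s).
  by rewrite -wy cutoffM cutoff_mem// numul0r.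
have FEs : FE w [set` s] by split; [exact: finite_seq|exact: exs|exact/negP].
have rs a : a \in s -> rng a = w by move=> ?; apply: exs.1.
have cE (t : seq (mor Lam)) : {subset t <= s} ->
    foldr (@numul R A) y [seq S (idp w) - S mu ** T mu | mu <- t] = cutoff t y
    /\ S (idp w) ** cutoff t y = cutoff t y.
  elim: t => // a t IH sub; have /= [|-> IH2] := IH.
    by move=> b bt; apply: sub; rewrite inE bt orbT.
  have ra : rng a = w by apply: rs; apply: sub; rewrite mem_head.
  rewrite numulDl numulNr IH2 numulA; split=> //.
  by rewrite numulDr numulrN IH2 !numulA -ra kp_idS.
have := kp4 fam FEs us erefl.
case: s us exs nws FEs rs cE => [|a s] us exs nws FEs rs cE.
  by have [|x] := exs.2 (idp w); first exact: rng_idp.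
move=> /= /(congr1 (fun z => z ** y)) /=; rewrite foldl_numul numul0r.
by have [/= -> _] := cE (a :: s) (fun _ => id).
Qed.

Lemma cutoff_ideal (I : set A) s x : nuideal I -> I x -> I (cutoff s x).
Proof.
move=> hI Ix; elim: s => //= a s IH; apply: nuidealB => //.
by apply/(nuidealMl hI)/(nuidealMl hI).
Qed.

(** Modulo [I], each factor subtracts S_a T_a applied to something congruent to [x], hence an
    element of [I]. *)
Lemma cutoff_sub_ideal (I : set A) s x : nuideal I ->
  (forall a, a \in s -> I (T a ** x)) -> I (x - cutoff s x).
Proof.
move=> hI; elim: s => [|a s IH] h /=; first by rewrite subrr; exact: nuideal0.
have Is : I (x - cutoff s x).
  by apply: IH => b bs; apply: h; rewrite inE bs orbT.
rewrite opprB addrCA; apply: nuidealD => //.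
have Ia : I (T a ** x) by apply: h; rewrite mem_head.
have -> : cutoff s x = x - (x - cutoff s x) by rewrite opprB addrC subrK.
apply: nuidealMl => //; rewrite numulDr numulrN; apply: nuidealB => //.
exact: nuidealMl.
Qed.

End Family.

Arguments numul : simpl never.

(** * The grading *)

Lemma subzE k (m n : deg k) i : subz m n i = (m i)%:Z - (n i)%:Z.
Proof. by rewrite ffunE. Qed.

Lemma zdegDE k (m n : {ffun 'I_k -> int}) i : (m + n) i = m i + n i.
Proof. by rewrite ffunE. Qed.

Lemma zdegNE k (m : {ffun 'I_k -> int}) i : (- m) i = - m i.
Proof. by rewrite ffunE. Qed.

Section KPStructure.
Context {k : nat} (Lam : kgraph k) (fa : finitely_aligned Lam) (R : comNzRingType).
Local Notation KPA := (KP R Lam).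
Local Notation s := (@kp_s k R Lam).
Local Notation t := (@kp_t k R Lam).
Local Notation fam := (@KP_kp_family k R Lam fa).
Implicit Types (v w : vtx Lam) (lam mu nu : mor Lam) (x y : KPA).

Lemma KP_ind (P : KPA -> Prop) :
  (forall lam, P (s lam)) -> (forall lam, P (t lam)) -> P 0 ->
  (forall x y, P x -> P y -> P (x + y)) ->
  (forall (a : R) x, P x -> P (a *: x)) ->
  (forall x y, P x -> P y -> P (x ** y)) -> forall x, P x.
Proof.
move=> Ps Pt P0 PD PZ PM x.
suff PC u : P (kp_class u).
  have -> : x = kp_class (kp_repr x) by apply/kp_ext => B S' T' f; rewrite kp_liftE.
  exact: PC.
elim: u => [lam|lam||u IH|u IHu w IHw|a u IH|u IHu w IHw].
- exact: Ps.
- exact: Pt.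
- exact: P0.
- have -> : kp_class (TOpp u) = (-1) *: kp_class u.
    by apply/kp_ext => B S' T' f; 
      rewrite !kp_liftE//= -!/(kp_lift _ _ _) !kp_liftE// scaleN1r.
  exact: PZ.
- have -> : kp_class (TAdd u w) = kp_class u + kp_class w.
    by apply/kp_ext => B S' T' f; 
      rewrite !kp_liftE//= -!/(kp_lift _ _ _) !kp_liftE.
  exact: PD.
- have -> : kp_class (TScale a u) = a *: kp_class u.
    by apply/kp_ext => B S' T' f; 
      rewrite !kp_liftE//= -!/(kp_lift _ _ _) !kp_liftE.
  exact: PZ.
- have -> : kp_class (TMul u w) = (kp_class u : KPA) ** (kp_class w : KPA).
    by apply/kp_ext => B S' T' f; 
      rewrite !kp_liftE//= -!/(kp_lift _ _ _) !kp_liftE.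
  exact: PM.
Qed.

Lemma sum_idp_l v (vs : seq (vtx Lam)) x : uniq vs -> v \in vs ->
  s (idp v) ** x = x -> \sum_(w <- vs) s (idp w) ** x = x.
Proof.
move=> uvs vvs vx; rewrite (bigD1_seq v)//= vx big1 ?addr0// => w wv.
by rewrite -vx numulA (kp1 fam) (negbTE wv) numul0r.
Qed.

Lemma sum_idp_r v (vs : seq (vtx Lam)) x : uniq vs -> v \in vs ->
  x ** s (idp v) = x -> \sum_(w <- vs) x ** s (idp w) = x.
Proof.
move=> uvs vvs vx; rewrite (bigD1_seq v)//= vx big1 ?addr0// => w wv.
by rewrite -vx -numulA (kp1 fam) eq_sym (negbTE wv) numulr0.
Qed.

(** Allowing every larger list of vertices makes the induction work: for sums and products the lists
    of the two operands are joined. *)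
Lemma local_unit x : exists vs : seq (vtx Lam), forall vs' : seq (vtx Lam), uniq vs' ->
  {subset vs <= vs'} -> \sum_(w <- vs') s (idp w) ** x = x /\
    \sum_(w <- vs') x ** s (idp w) = x.
Proof.
elim/KP_ind: x => [lam|lam||x y [vs h] [vs' h']|a x [vs h]|x y [vs h] [vs' h']].
- exists [:: rng lam; src lam] => vs' us sub; split.
    by apply: (@sum_idp_l (rng lam)); rewrite ?sub ?inE ?eqxx// (kp_idS fam).
  by apply: (@sum_idp_r (src lam)); rewrite ?sub ?inE ?eqxx ?orbT// (kp_Sid fam).
- exists [:: rng lam; src lam] => vs' us sub; split.
    by apply: (@sum_idp_l (src lam)); rewrite ?sub ?inE ?eqxx ?orbT// (kp_idT fam).
  by apply: (@sum_idp_r (rng lam)); rewrite ?sub ?inE ?eqxx// (kp_Tid fam).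
- by exists [::] => vs' _ _; rewrite !big1// => w _; rewrite ?numul0r ?numulr0.
- exists (vs ++ vs') => ws us sub.
  have [||h1 h2] := h ws => //; first by move=> w wvs; apply: sub; rewrite mem_cat wvs.
  have [||h3 h4] := h' ws => //.
    by move=> w wvs; apply: sub; rewrite mem_cat wvs orbT.
  split.
    by rewrite -[RHS](f_equal2 +%R h1 h3) -big_split;
      apply: eq_bigr => w _; rewrite numulDr.
  by rewrite -[RHS](f_equal2 +%R h2 h4) -big_split;
      apply: eq_bigr => w _; rewrite numulDl.
- exists vs => ws us sub; have [h1 h2] := h ws us sub; split.
    by under eq_bigr do rewrite numulZr; rewrite -scaler_sumr h1.
  by under eq_bigr do rewrite numulZl; rewrite -scaler_sumr h2.
- exists (vs ++ vs') => ws us sub.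
  have [||h1 _] := h ws => //; first by move=> w wvs; apply: sub; rewrite mem_cat wvs.
  have [||_ h2] := h' ws => //.
    by move=> w wvs; apply: sub; rewrite mem_cat wvs orbT.
  split.
    by under eq_bigr do rewrite numulA; rewrite -numul_suml h1.
  by under eq_bigr do rewrite -numulA; rewrite -numul_sumr h2.
Qed.

Lemma local_unit_l x : exists vs : seq (vtx Lam), x = \sum_(w <- vs) s (idp w) ** x.
Proof.
have [vs h] := local_unit x; exists (undup vs).
have [||-> _] := h (undup vs) => //; first exact: undup_uniq.
by move=> w; rewrite mem_undup.
Qed.

Lemma local_unit_r x : exists vs : seq (vtx Lam), x = \sum_(w <- vs) x ** s (idp w).
Proof.
have [vs h] := local_unit x; exists (undup vs).
have [||_ ->] := h (undup vs) => //; first exact: undup_uniq.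
by move=> w; rewrite mem_undup.
Qed.

Local Notation zdeg := {ffun 'I_k -> int}.

Lemma KP_deg_mono mu nu : src mu = src nu ->
  KP_deg R Lam (subz (dg mu) (dg nu)) (s mu ** t nu).
Proof.
by move=> h; rewrite -[_ ** _]scale1r; apply: lincomb_gen => //; exists mu, nu.
Qed.

(** (KP3) expands a product of monomials into monomials, and [Lmin_dg] makes their degrees add. *)
Lemma KP_degM (m n : zdeg) x y :
  KP_deg R Lam m x -> KP_deg R Lam n y -> KP_deg R Lam (m + n) (x ** y).
Proof.
move=> + hy; move: x; apply: lincomb_ind => [|{}x z hx hz|a _ _ [mu [nu [mn dmn ->]]]].
- by rewrite numul0r; exact: lincomb0.
- by rewrite numulDl; exact: lincombD.
rewrite numulZl; apply: lincombZ.
move: y hy; apply: lincomb_ind => [|{}x z hx hz|b _ _ [sig [tau [st dst ->]]]].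
- by rewrite numulr0; exact: lincomb0.
- by rewrite numulDr; exact: lincombD.
rewrite numulZr; apply: lincombZ.
rewrite numulA -[s mu ** t nu ** s sig]numulA (kp3 fam).
have [r [_ rP ->]] := fsbig_seqE (fa nu sig).
rewrite numul_sumr numul_suml big_seq.
apply: (big_ind (KP_deg R Lam (m + n))); [exact: lincomb0|exact: lincombD|].
move=> p /rP hp; have [h1 h2 _ _] := hp.
have h1' : src mu = rng p.1 by rewrite mn.
have h2' : src tau = rng p.2 by rewrite -st.
rewrite numulA -numulA (kp_TT fam h2') (kp_SS fam h1').
have -> : m + n = subz (dg (comp mu p.1)) (dg (comp tau p.2)).
  apply/ffunP => i; have := congr1 (fun d : deg k => d i) (Lmin_dg hp).
  rewrite /= !degDE -dmn -dst zdegDE !subzE !dg_comp// !degDE.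
  lia.
apply: KP_deg_mono; rewrite !src_comp//.
exact: Lmin_src hp.
Qed.

Lemma KP_hom_sum x : lincomb setT [set y | exists n, KP_deg R Lam n y] x.
Proof.
have gen y n : KP_deg R Lam n y -> lincomb setT [set y | exists n, KP_deg R Lam n y] y.
  by move=> h; rewrite -[y]scale1r; apply: lincomb_gen => //; exists n.
elim/KP_ind: x => [lam|lam||x y hx hy|a x hx|x y hx hy].
- rewrite -(kp_Sid fam) -(kp_ghost_vtx fam); apply: gen; apply: KP_deg_mono.
  by rewrite src_idp.
- rewrite -(kp_idT fam); apply: gen; apply: KP_deg_mono.
  by rewrite src_idp.
- exact: lincomb0.
- exact: lincombD.
- exact: lincombZ.
move: x hx; apply: lincomb_ind => [|{}x z hx hz|a {}x _ [m hx]].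
- by rewrite numul0r; exact: lincomb0.
- by rewrite numulDl; exact: lincombD.
rewrite numulZl; apply: lincombZ.
move: y hy; apply: lincomb_ind => [|{}y z hy hz|b {}y _ [n hy]].
- by rewrite numulr0; exact: lincomb0.
- by rewrite numulDr; exact: lincombD.
rewrite numulZr; apply: lincombZ.
by apply: gen; exact: KP_degM hx hy.
Qed.

End KPStructure.

(** * The action on functions on Z^k and independence of the homogeneous components *)

Section Grading.
Context {k : nat} (Lam : kgraph k) (fa : finitely_aligned Lam) (R : comNzRingType).
Local Notation KPA := (KP R Lam).
Local Notation s := (@kp_s k R Lam).
Local Notation t := (@kp_t k R Lam).
Local Notation fam := (@KP_kp_family k R Lam fa).
Local Notation zdeg := {ffun 'I_k -> int}.
Implicit Types (v w : vtx Lam) (lam mu nu : mor Lam) (x y : KPA).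

(* KP acts on functions Z^k -> KP so that an element of degree m
   multiplies the values and translates the argument by m. *)
Definition zspace : lmodType R := zdeg -> KPA.

Implicit Types (f g : zspace).

Definition zs_fun lam f : zspace := fun n => s lam ** f (n - subz (dg lam) 0).
Definition zt_fun lam f : zspace := fun n => t lam ** f (n + subz (dg lam) 0).

Lemma zs_subproof lam : zs_fun lam \in is_linear.
Proof.
apply/asboolP => a f g; apply/funext => n.
change (zs_fun lam (a *: f + g) n = a *: zs_fun lam f n + zs_fun lam g n).
by rewrite /zs_fun -numulZr -numulDr.
Qed.

Lemma zt_subproof lam : zt_fun lam \in is_linear.
Proof.
apply/asboolP => a f g; apply/funext => n.
change (zt_fun lam (a *: f + g) n = a *: zt_fun lam f n + zt_fun lam g n).
by rewrite /zt_fun -numulZr -numulDr.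
Qed.

Definition zs lam : End zspace :=
  exist (fun h => h \in is_linear) (zs_fun lam) (zs_subproof lam).
Definition zt lam : End zspace :=
  exist (fun h => h \in is_linear) (zt_fun lam) (zt_subproof lam).

Lemma subz_idp v : subz (dg (idp v)) 0 = 0 :> zdeg.
Proof. by apply/ffunP => i; rewrite subzE dg_idp subrr ffunE. Qed.

Lemma subz_comp mu nu : src mu = rng nu ->
  subz (dg (comp mu nu)) 0 = subz (dg mu) 0 + subz (dg nu) 0 :> zdeg.
Proof.
move=> h; apply/ffunP => i; rewrite zdegDE !subzE ffunE dg_comp// degDE.
by lia.
Qed.

Lemma zs_zt lam f n : zs_fun lam (zt_fun lam f) n = s lam ** (t lam ** f n).
Proof. by rewrite /zs_fun /zt_fun subrK. Qed.

Lemma graded_kp_family : kp_family zs zt.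
Proof.
split=> [v|v w|mu nu h|mu nu|v E EF l ul lE].
- apply: endo_ext => f; apply/funext => n.
  change (zt_fun (idp v) f n = zs_fun (idp v) f n).
  by rewrite /zt_fun /zs_fun subz_idp subr0 addr0 (kp_ghost_vtx fam).
- apply: endo_ext => f; apply/funext => n.
  change (zs_fun (idp v) (zs_fun (idp w) f) n =
    (val (if v == w then zs (idp v) else 0) f) n).
  rewrite /zs_fun !subz_idp !subr0 numulA (kp1 fam).
  case: ifP => _; last by rewrite numul0r.
  by change (s (idp v) ** f n = zs_fun (idp v) f n); rewrite /zs_fun subz_idp subr0.
- split; apply: endo_ext => f; apply/funext => n.
    change (zs_fun mu (zs_fun nu f) n = zs_fun (comp mu nu) f n).
    by rewrite /zs_fun numulA (kp_SS fam)// subz_comp// opprD addrA.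
  change (zt_fun nu (zt_fun mu f) n = zt_fun (comp mu nu) f n).
  rewrite /zt_fun numulA (kp_TT fam)// subz_comp// -addrA.
  by rewrite [subz _ _ + _]addrC.
- have [r [_ rP rE]] := fsbig_seqE (fa mu nu).
  rewrite rE; apply: endo_ext => f; apply/funext => n.
  rewrite (endo_sumE r) fct_sumE.
  change (zt_fun mu (zs_fun nu f) n =
    \sum_(p <- r) zs_fun p.1 (zt_fun p.2 f) n).
  rewrite /zt_fun /zs_fun numulA (kp3 fam) rE numul_suml.
  apply: eq_big_seq => p /rP hp; rewrite numulA; congr (_ ** f _).
  (* The translations agree because d(mu) + d(p.1) = d(nu) + d(p.2). *)
  have := congr1 (fun d => subz d 0) (Lmin_dg hp); move: (hp) => [h1 h2 _ _].
  rewrite -!dg_comp// !subz_comp// => e.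
  rewrite -!addrA; congr (_ + _).
  apply/eqP; rewrite eq_sym addrC subr_eq addrAC eq_sym subr_eq.
  by rewrite e addrC.
- apply: endo_ext => f; apply/funext => n; change ((val (nuprod
    [seq zs (idp v) - zs mu ** zt mu | mu <- l]) f) n = 0).
  have := kp4 fam EF ul lE; case: l {ul lE} => [//|mu0 l].
  rewrite /nuprod /= => /(congr1 (fun z => z ** f n)).
  rewrite foldl_numul numul0r foldl_endo_mul => e.
  (* The translations of [zs mu] and [zt mu] cancel, so (KP4) holds pointwise by (KP4) in the
     algebra. *)
  have actE mu g m : (val (zs (idp v) - zs mu ** zt mu) g) m =
      (s (idp v) - s mu ** t mu) ** g m.
    change (zs_fun (idp v) g m - zs_fun mu (zt_fun mu g) m =
      (s (idp v) - s mu ** t mu) ** g m).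
    by rewrite zs_zt /zs_fun subz_idp subr0 numulDl numulNr numulA.
  rewrite -e; have foldE : forall m, (
    foldr (fun (h : endo zspace) (y : zspace) => val h y) f
     [seq zs (idp v) - zs mu ** zt mu | mu <- l]) m =
     foldr (@numul R KPA) (f m) [seq s (idp v) - s mu ** t mu | mu <- l].
    by elim: l {e} => //= mu l IH m; apply: etrans (actE _ _ _) _; rewrite IH.
  by apply: etrans (actE _ _ _) _; rewrite -foldE.
Qed.

Lemma graded_actionE (m : zdeg) x f n : KP_deg R Lam m x ->
  (val (kp_lift zs zt x : endo zspace) f) n = x ** f (n - m).
Proof.
have hom := kp_lift_hom graded_kp_family.
have hom0 : kp_lift zs zt 0 = 0.
  by apply: (addIr (kp_lift zs zt 0)); rewrite -(nuhomD hom) !add0r.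
move: x; apply: lincomb_ind => [|x y hx hy|a x _ [mu [nu [mn dE ->]]]].
- by rewrite hom0 numul0r.
- by rewrite (nuhomD hom) numulDl -hx -hy.
rewrite (nuhomZ hom) (nuhomM hom) !(kp_liftE graded_kp_family).
rewrite numulZl -numulA.
change (a *: zs_fun mu (zt_fun nu f) n = a *: (s mu ** (t nu ** f (n - m)))).
rewrite /zs_fun /zt_fun; congr (_ *: (_ ** (_ ** f _))).
rewrite -dE -addrA; congr (_ + _); apply/ffunP => i.
by rewrite zdegDE !zdegNE !subzE ffunE; lia.
Qed.

Lemma fsumT_seq (T : choiceType) (V : nmodType) (F : T -> V) (r : seq T) : uniq r ->
  (forall i, i \notin r -> F i = 0) -> \sum_(i \in [set: T]) F i = \sum_(i <- r) F i.
Proof.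
move=> ur h; rewrite (fsbigE r)//; last by move=> i _; exact: h.
by apply: eq_bigl => i; rewrite in_setT.
Qed.

Lemma finite_supp_seq (T : choiceType) (V : nmodType) (F : T -> V) :
  finite_set [set n | F n != 0] ->
  exists2 r : seq T, uniq r & forall i, i \notin r -> F i = 0.
Proof.
move=> /fsbig_seqE[r [ur rP _]]; exists r => // i; apply: contraNeq => Fi.
exact/rP.
Qed.

(** Let the sum act on the function with value s_w at 0 and zero elsewhere. At the point [m] only
    the component of degree [m] contributes, so [f m] times s_w vanishes for all w; local units give
    [f m] = 0. *)
Lemma KP_deg_independent (f : zdeg -> KPA) : finite_set [set n | f n != 0] ->
  (forall n, KP_deg R Lam n (f n)) -> \sum_(n \in [set: zdeg]) f n = 0 ->
  forall n, f n = 0.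
Proof.
move=> /finite_supp_seq[r ur hr] fdeg; rewrite (fsumT_seq ur hr) => f0 m.
have [mr|/hr//] := boolP (m \in r).
have [vs ->] := local_unit_r fa (f m); rewrite big1// => w _.
have hom := kp_lift_hom graded_kp_family.
have hom0 : kp_lift zs zt 0 = 0.
  by apply: (addIr (kp_lift zs zt 0)); rewrite -(nuhomD hom) !add0r.
pose g : zspace := fun n => if n == 0 then s (idp w) else 0.
have := congr1 (fun x => val (kp_lift zs zt x : endo zspace) g m) f0.
rewrite hom0 (big_morph (kp_lift zs zt) (nuhomD hom) hom0).
rewrite (endo_sumE r) fct_sumE (bigD1_seq m)//= big1_seq => [|n /andP[nm _]].
  by rewrite (graded_actionE _ _ (fdeg m)) subrr /g eqxx addr0.
by rewrite (graded_actionE _ _ (fdeg n)) /g subr_eq0 eq_sym (negbTE nm) numulr0.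
Qed.

(** Directness is [KP_deg_independent], so only generation by homogeneous elements remains; terms of
    equal degree are collected. *)
Lemma graded_ideal_hom (I : set KPA) : nuideal I ->
  (forall x, I x -> lincomb setT [set y | I y /\ exists n, KP_deg R Lam n y] x) ->
  graded_ideal I.
Proof.
move=> hI h; split=> //; split; last first.
  by move=> f fs fI; apply: KP_deg_independent => // n; case: (fI n).
move=> x; split=> [Ix|[f [/finite_supp_seq[r ur hr] fI ->]]]; last first.
  by rewrite (fsumT_seq ur hr); apply: nuideal_sum => // n _; case: (fI n).
have [f [r [ur hr fI xE]]] : exists (f : zdeg -> KPA) (r : seq zdeg), [/\ uniq r,
    forall i, i \notin r -> f i = 0, forall n, (I `&` KP_deg R Lam n) (f n) &
    x = \sum_(n <- r) f n].
  have I0 n : (I `&` KP_deg R Lam n) 0.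
    by split; [exact: nuideal0|exact: lincomb0].
  move: {Ix} x (h x Ix); apply: lincomb_ind =>
    [|x y [f [r [ur hr fI ->]]] [g [q [uq hq gI ->]]]|a x _ [Ix [m xm]]].
  - by exists (fun=> 0), [::]; rewrite big_nil.
  - have uu : uniq (undup (r ++ q)) := undup_uniq _.
    exists (fun n => f n + g n), (undup (r ++ q)); split=> //.
    + by move=> i; rewrite mem_undup mem_cat => /norP[/hr -> /hq ->]; rewrite addr0.
    + move=> n; case: (fI n) => f1 f2; case: (gI n) => g1 g2.
      by split; [exact: nuidealD|exact: lincombD].
    + rewrite big_split -(fsumT_seq ur hr) -(fsumT_seq uq hq).
      by congr (_ + _); apply: fsumT_seq => // i;
        rewrite mem_undup mem_cat => /norP[/hr ? /hq ?].
  - exists (fun n => if n == m then a *: x else 0), [:: m]; split=> //.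
    + by move=> i; rewrite inE => /negbTE ->.
    + move=> n; case: eqP => [->|_] //.
      by split; [exact: nuidealZ|exact: lincombZ].
    + by rewrite big_seq1 eqxx.
exists f; split=> //.
- apply: (sub_finite_set _ (finite_seq r)) => n /= fn.
  by apply: contraNT fn => /hr ->.
- by rewrite (fsumT_seq ur hr).
Qed.

End Grading.

Lemma count_lt (T : eqType) (P Q : pred T) (l : seq T) x : x \in l -> P x -> ~~ Q x ->
  (forall y, Q y -> P y) -> (count Q l < count P l)%N.
Proof.
move=> xl Px nQx QP; elim: l xl => // y l IH; rewrite inE /= => /orP[/eqP <-|/IH lt].
  by rewrite Px (negbTE nQx) add0n add1n ltnS sub_count.
rewrite -addnS leq_add//.
by case: (Q y) (QP y) => // ->.
Qed.

(** * Graded ideals *)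

Section GradedIdeals.
Context {k : nat} (Lam : kgraph k) (fa : finitely_aligned Lam) (R : comNzRingType).
Local Notation KPA := (KP R Lam).
Local Notation s := (@kp_s k R Lam).
Local Notation t := (@kp_t k R Lam).
Local Notation fam := (@KP_kp_family k R Lam fa).
Implicit Types (v w : vtx Lam) (lam mu nu : mor Lam) (x y : KPA).

Section Ideal.
Variables (I : set KPA) (hI : nuideal I).

Lemma vertex_hereditary (r : R) : hereditary [set v | I (r *: s (idp v))].
Proof.
move=> lam /= /(nuidealMl hI (t lam)) /(nuidealMr hI (s lam)).
by rewrite numulZr numulZl (kp_Tid fam) (kp_TS fam).
Qed.

(** By (KP4) the cutoff along [E] kills r s_v. Modulo [I] it does not change r s_v, since t_a (r
    s_v) = (r s_w) t_a with w = [src a]. *)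
Lemma vertex_saturated (r : R) : saturated [set v | I (r *: s (idp v))].
Proof.
move=> v E FEE sub /=; have [l ul lE] := FE_seq FEE.
have [fE exE _] := FEE.
have c0 : cutoff s t l (r *: s (idp v)) = 0.
  apply: (cutoff_exhaustive fa fam (w := v)) => //; first by rewrite lE.
  by rewrite numulZr (kp1 fam) eqxx.
rewrite -[r *: _]subr0 -c0; apply: (cutoff_sub_ideal s hI) => a al.
have Ea : E a by rewrite -lE.
rewrite numulZr -(exE.1 _ Ea) (kp_Tid fam) -(kp_idT fam) -numulZl.
apply: (nuidealMr hI).
by have /sub : [set src x | x in E] (src a) by exists a.
Qed.

Variable J : set R.
Hypothesis hJ : rideal J.
Hypothesis IJ : forall r v, I (r *: s (idp v)) -> J r.

(** Distinct paths of equal degree are orthogonal: right multiplication by [s (comp e g)] isolates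
    the coefficient of [e], times a vertex, and [IJ] puts it in [J]. *)
Lemma ghost_sum_coef (d : deg k) g (l : seq (R * mor Lam)) :
  (forall p, p \in l -> dg p.2 = d /\ src p.2 = rng g) ->
  I (\sum_(p <- l) p.1 *: t (comp p.2 g)) ->
  lincomb J [set: KPA] (\sum_(p <- l) p.1 *: t p.2).
Proof.
move=> hl Il; pose U := undup [seq p.2 | p <- l].
(* Paths may repeat in [l], so their coefficients are merged first. *)
have -> : \sum_(p <- l) p.1 *: t p.2 =
    \sum_(e <- U) (\sum_(p <- l | p.2 == e) p.1) *: t e.
  transitivity (\sum_(p <- l) \sum_(e <- U) (if p.2 == e then p.1 *: t e else 0)).
    apply: eq_big_seq => p pl; rewrite (bigD1_seq p.2) ?undup_uniq//=; last first.
      by rewrite mem_undup; apply: map_f.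
    by rewrite eqxx big1 ?addr0// => e; rewrite eq_sym => /negbTE ->.
  rewrite exchange_big; apply: eq_bigr => e _.
  rewrite scaler_suml [RHS]big_mkcond; apply: eq_bigr => p _.
  by case: eqP => // ->.
rewrite big_seq; apply: big_ind; [exact: lincomb0|exact: lincombD|].
move=> e; rewrite mem_undup => /mapP[q ql ->].
have [dq sq] := hl q ql.
apply: lincomb_gen => //; apply: (IJ (v := src g)).
have -> : (\sum_(p <- l | p.2 == q.2) p.1) *: s (idp (src g)) =
    (\sum_(p <- l) p.1 *: t (comp p.2 g)) ** s (comp q.2 g).
  rewrite numul_suml scaler_suml [LHS]big_mkcond; apply: eq_big_seq => p pl.
  have [dp sp] := hl p pl.
  rewrite numulZl (kp_TS_eqdg fam); last by rewrite !dg_comp// dp dq.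
  have -> : (comp p.2 g == comp q.2 g) = (p.2 == q.2).
    apply/eqP/eqP => [e'|->//].
    by apply: (proj1 (comp_inj sp sq e' _)); rewrite dp dq.
  by case: ifP => _; rewrite ?src_comp// scaler0.
exact: (nuidealMr hI).
Qed.

Section Homogeneous.
Variables (n : {ffun 'I_k -> int}) (l : seq (R * (mor Lam * mor Lam))).
Hypothesis l_src : forall p, p \in l -> src p.2.1 = src p.2.2.
Hypothesis l_deg : forall p, p \in l -> subz (dg p.2.1) (dg p.2.2) = n.
Let x : KPA := \sum_(p <- l) p.1 *: (s p.2.1 ** t p.2.2).
Hypothesis Ix : I x.

Let extends lam (p : R * (mor Lam * mor Lam)) :=
  `[< exists a, src p.2.1 = rng a /\ lam = comp p.2.1 a >].

Let undecided lam (p : R * (mor Lam * mor Lam)) :=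
  ~~ extends lam p && `[< Lmin lam p.2.1 !=set0 >].

(** A leg that begins [lam] also begins [comp lam a], and a leg compatible with [comp lam a] is
    compatible with [lam]; so extending [lam] creates no undecided legs. *)
Let undecided_comp lam a p : src lam = rng a ->
  undecided (comp lam a) p -> undecided lam p.
Proof.
move=> la /andP[ne /asboolP[[c d] [/= h1 h2 e _]]]; apply/andP; split.
  apply: contra ne => /asboolP[b [pb e']]; apply/asboolP.
  by exists (comp b a); rewrite rng_comp ?compA -?e'// -la e' src_comp.
have ac : src a = rng c by rewrite -h1 src_comp.
apply/asboolP; have [||p' [_ [hp _ _ _ _]]] := @min_ext _ _ lam p.2.1 (comp a c) d _ h2.
- by rewrite rng_comp.
- by rewrite compA.
by exists p'.
Qed.

(* Induction on the number of left legs mu in l that are neither an initial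
   segment of lam nor incompatible with lam. The cutoff by the extensions of
   lam towards these legs kills their contribution, and if the cutoff is not
   zero then the extensions are not exhaustive, so that some lam g is
   decided for all of l. *)
Lemma ghost_mul_lincomb lam : lincomb J [set: KPA] (t lam ** x).
Proof.
have hJKP : nuideal (lincomb J [set: KPA]) := nuideal_lincomb _ hJ.
have [N] := ubnP (count (undecided lam) l); elim: N lam => // N IH lam ltN.
pose M := [set mu | exists2 p, p \in l & undecided lam p /\ mu = p.2.1].
have fM : finite_set M.
  apply: (sub_finite_set _ (finite_seq [seq p.2.1 | p <- l])).
  by move=> mu [p pl [_ ->]] /=; exact: map_f.
have [E [uE EP _]] := fsbig_seqE (finite_Ext lam fa fM).
have rE a : a \in E -> src lam = rng a by move=> /EP[mu _ [b []]].
set X := t lam ** x.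
(* For [a] in [E], [comp lam a] begins with a leg that was undecided for [lam], so the count drops
   and the induction hypothesis applies to t_a X. *)
have IH' : lincomb J [set: KPA] (X - cutoff s t E X).
  apply: (cutoff_sub_ideal s hJKP) => a aE; have la := rE a aE.
  rewrite /X numulA (kp_TT fam)//; apply: IH; apply: leq_trans (ltN : (_ <= N)%N).
  have /EP/Ext_extends[mu [b [[p pl [up ->]] _ pb e]]] := aE.
  apply: (count_lt pl up) => [|q]; last exact: undecided_comp.
  rewrite /undecided negb_and negbK; apply/orP; left; apply/asboolP.
  by exists b.
(* [a p] is what remains of [lam] after the left leg of [p]; its value is junk when that leg does
   not begin [lam]. *)
pose a (p : R * (mor Lam * mor Lam)) : mor Lam :=
  if pselect (exists a, src p.2.1 = rng a /\ lam = comp p.2.1 a) is left h then projT1 (cid h) else lam.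
have aP p : extends lam p -> src p.2.1 = rng (a p) /\ lam = comp p.2.1 (a p).
  by move=> /asboolP h; rewrite /a; case: pselect => // h'; case: cid.
(* [y] collects the terms whose left leg begins [lam]; there t_lam s_mu t_nu is the ghost of nu
   prolonged by [a p]. The rest is [z]. *)
pose y : KPA := \sum_(p <- [seq (p.1, comp p.2.2 (a p)) | p <- l & extends lam p])
  p.1 *: t p.2.
pose z : KPA := \sum_(p <- [seq p <- l | ~~ extends lam p])
  p.1 *: (t lam ** (s p.2.1 ** t p.2.2)).
have XE : X = y + z.
  rewrite /X /x numul_sumr (bigID (extends lam)) /=; congr (_ + _); last first.
    by rewrite /z big_filter; apply: eq_bigr => p _; rewrite numulZr.
  rewrite /y big_map big_filter big_seq_cond [RHS]big_seq_cond.
  apply: eq_bigr => p /andP[pl /aP[h e]].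
  by rewrite numulZr numulA {1}e (kp_TS_ext fam)// (kp_TT fam) -?l_src.
(* A term with an incompatible leg is zero. For an undecided leg, (KP3) gives terms that begin with
   some s_a, [a] in [E], which the cutoff kills. *)
have cz : cutoff s t E z = 0.
  rewrite /z cutoff_sum big1_seq// => p; rewrite mem_filter /= => /andP[ne pl].
  rewrite cutoffZ numulA cutoffM (kp3 fam).
  have [r [_ rP ->]] := fsbig_seqE (fa lam p.2.1).
  rewrite cutoff_sum big1_seq ?numul0r ?scaler0// => q /= /rP hq.
  rewrite cutoffM (cutoff_mem fa fam) ?numul0r//; apply/EP.
  exists p.2.1; last by exists q.2; case: q hq.
  by exists p => //; split=> //; rewrite /undecided ne; apply/asboolP; exists q.
have [exE|nexE] := pselect (exhaustive (src lam) [set` E]).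
  have c0 : cutoff s t E X = 0.
    apply: (cutoff_exhaustive fa fam uE exE).
    by rewrite /X numulA (kp_idT fam).
  by rewrite c0 subr0 in IH'.
have [g rg gE] : exists2 g, rng g = src lam & forall mu, mu \in E -> Lmin g mu = set0.
  apply: contrapT => no; apply: nexE; split=> [mu /rE ->//|g rg].
  apply: contrapT => h; apply: no; exists g => // mu muE.
  apply/eqP; apply: contrapT => /negP/set0P ne; apply: h; by exists mu.
(* A common extension of [comp lam g] with such a leg would pass through a member of [E], against
   the choice of [g]. *)
have gz : t g ** z = 0.
  rewrite /z numul_sumr big1_seq// => p; rewrite mem_filter /= => /andP[ne pl].
  rewrite numulZr !numulA (kp_TT fam)// (kp_TS0 fam) ?numul0r ?scaler0//.
  apply/seteqP; split=> // -[c d] [/= h1 h2 e _].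
  have gc : src g = rng c by rewrite -h1 src_comp.
  have [||[c' d'] [d2 [hp s1 s2 e1 e2]]] := @min_ext _ _ lam p.2.1 (comp g c) d _ h2.
  - by rewrite rng_comp.
  - by rewrite compA.
  have c'E : c' \in E.
    apply/EP; exists p.2.1; last by exists d'.
    exists p => //; split=> //; rewrite /undecided ne.
    by apply/asboolP; exists (c', d').
  have [q [_ [hq _ _ _ _]]] := min_ext gc s1 e1.
  by have := gE _ c'E; move: hq => /[swap] ->.
have Jy : lincomb J [set: KPA] y.
  (* The ghost paths all have degree d(lam) - n; the absolute value only brings this nonnegative
     difference back to the naturals. *)
  apply: (@ghost_sum_coef [ffun i => `|(dg lam i)%:Z - n i|%N] g).
    move=> _ /mapP[p + ->] /=; rewrite mem_filter => /andP[/aP[h e] pl].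
    have h' : src p.2.2 = rng (a p) by rewrite -l_src.
    split; last by rewrite rg src_comp// e src_comp.
    apply/ffunP => i; rewrite ffunE -(l_deg pl) subzE {1}e !dg_comp// !degDE.
    by move: (dg p.2.2 i) (dg (a p) i) (dg p.2.1 i) => b c d; lia.
  suff -> : \sum_(p <- [seq (p.1, comp p.2.2 (a p)) | p <- l & extends lam p])
      p.1 *: t (comp p.2 g) = t g ** X.
    by do 2!apply: (nuidealMl hI).
  rewrite XE numulDr gz addr0 /y numul_sumr; apply: eq_big_seq.
  move=> _ /mapP[p + ->] /=; rewrite mem_filter => /andP[/aP[h e] pl].
  by rewrite numulZr (kp_TT fam)// rg src_comp -?l_src// e src_comp.
(* Modulo J KP_R, [X] equals its cutoff, which is the cutoff of [y]. *)
rewrite -[X](subrK (cutoff s t E X)); apply: (nuidealD hJKP) => //.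
rewrite XE cutoffD cz addr0; exact: (cutoff_ideal s t E hJKP).
Qed.

End Homogeneous.
End Ideal.
End GradedIdeals.

(** * The equivalences *)

Section Implications.
Context {k : nat} (Lam : kgraph k) (fa : finitely_aligned Lam) (R : comNzRingType).
Local Notation KPA := (KP R Lam).
Local Notation s := (@kp_s k R Lam).
Local Notation t := (@kp_t k R Lam).
Local Notation fam := (@KP_kp_family k R Lam fa).
Implicit Types (v w : vtx Lam) (lam mu nu : mor Lam) (x y : KPA).

Lemma cofinal_hereditary_saturated (H : set (vtx Lam)) : cofinal Lam ->
  hereditary H -> saturated H -> H = set0 \/ H = setT.
Proof.
move=> cof herH satH; have [[w Hw]|H0] := pselect (exists w, H w); last first.
  by left; apply/seteqP; split=> // w Hw; apply: H0; exists w.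
right; apply/seteqP; split=> // v _; apply: contrapT => nHv.
have [F [bF _ nHF]] := avoiding_bfilter fa herH satH nHv.
have [m [x [bx xF]]] := omega_path_bfilter bF.
have [n nm [lam [rl sl]]] := cof w m x bx.
have [a Fa xa] := xF n nm; apply: (nHF a Fa).
by rewrite -xa -sl; apply: herH; rewrite rl.
Qed.

Lemma KP_deg_seq (n : {ffun 'I_k -> int}) x : KP_deg R Lam n x ->
  exists l : seq (R * (mor Lam * mor Lam)),
  [/\ forall p, p \in l -> src p.2.1 = src p.2.2,
    forall p, p \in l -> subz (dg p.2.1) (dg p.2.2) = n &
    x = \sum_(p <- l) p.1 *: (s p.2.1 ** t p.2.2)].
Proof.
move: x; apply: lincomb_ind =>
  [|x y [l [h1 h2 ->]] [l' [h3 h4 ->]]|a _ _ [mu [nu [mn dE ->]]]].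
- by exists [::]; rewrite big_nil.
- exists (l ++ l'); rewrite big_cat; split=> // p; rewrite mem_cat => /orP[].
  + exact: h1.
  + exact: h3.
  + exact: h2.
  + exact: h4.
- exists [:: (a, (mu, nu))]; rewrite big_seq1; split=> // p; rewrite inE => /eqP -> //.
Qed.

Lemma KP_lincombT (J : set R) : J 1 -> lincomb J [set: KPA] = setT.
Proof.
move=> J1; apply/seteqP; split=> // x _; rewrite -[x]scale1r.
exact: lincomb_gen.
Qed.

Lemma graded_ideal_lincomb (I : set KPA) :
  (forall H : set (vtx Lam), hereditary H -> saturated H -> H = set0 \/ H = setT) ->
  graded_ideal I -> exists2 J : set R, rideal J & I = lincomb J setT.
Proof.
move=> hs [hI [dI _]]; pose J : set R := [set r | forall v, I (r *: s (idp v))].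
have hJ : rideal J.
  split=> [v|a b Ja Jb v|c a Ja v].
  - by rewrite scale0r; exact: nuideal0.
  - by rewrite scalerDl; apply: (nuidealD hI).
  - by rewrite -scalerA; apply: (nuidealZ hI).
(* The vertices w with r s_w in [I] form a saturated hereditary set, so one such vertex yields all
   of them. *)
have IJ r v : I (r *: s (idp v)) -> J r.
  move=> Iv w; have [H0|HT] := hs _ (@vertex_hereditary _ _ fa _ _ hI r)
    (@vertex_saturated _ _ fa _ _ hI r).
    by have : set0 v by rewrite -H0.
  by have : [set: vtx Lam] w by []; rewrite -HT.
have hJKP : nuideal (lincomb J [set: KPA]) := nuideal_lincomb _ hJ.
exists J => //; apply/seteqP; split=> x; last first.
  move: x; apply: lincomb_ind; [exact: nuideal0|exact: (nuidealD hI)|move=> a x Ja _].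
  have [vs ->] := local_unit_l fa x; rewrite scaler_sumr.
  apply: (nuideal_sum hI) => w _; rewrite -numulZl.
  by apply: (nuidealMr hI); exact: Ja.
move=> /dI[f [/finite_supp_seq[r ur hr] fI ->]].
rewrite (fsumT_seq ur hr); apply: (nuideal_sum hJKP) => n _.
have [If /KP_deg_seq[l [h1 h2 fE]]] := fI n.
(* Since s_w = t_w, local units reduce the component to terms covered by [ghost_mul_lincomb] with
   [lam] a vertex. *)
have [vs ->] := local_unit_l fa (f n); apply: (nuideal_sum hJKP) => w _.
rewrite -(kp_ghost_vtx fam) fE; apply: (ghost_mul_lincomb fa hI hJ IJ h1 h2).
by rewrite -fE.
Qed.

Lemma degree0_ideal_graded (I : set KPA) : nuideal I ->
  exists2 I0 : set KPA, graded_ideal I0 & I `&` KP_deg R Lam 0 `<=` I0 /\ I0 `<=` I.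
Proof.
move=> hI; pose I0 : set KPA := [set x | forall K : set KPA, nuideal K ->
  I `&` KP_deg R Lam 0 `<=` K -> K x].
have hI0 : nuideal I0.
  split.
  - by move=> K hK _; exact: nuideal0.
  - by move=> x y hx hy K hK sub; apply: (nuidealD hK); [apply: hx|apply: hy].
  - by move=> a x hx K hK sub; apply: (nuidealZ hK); apply: hx.
  - move=> x y hx; split=> K hK sub.
      by apply: (nuidealMr hK); apply: hx.
    by apply: (nuidealMl hK); apply: hx.
have sub0 : I `&` KP_deg R Lam 0 `<=` I0 by move=> x hx K _; apply.
exists I0; last first.
  by split=> // x; apply => // y [].
(* The span of the homogeneous elements of [I0] is itself an ideal containing the generators, so by
   minimality it contains [I0]. *)
apply: (graded_ideal_hom fa hI0) => x /(_ (lincomb setT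
  [set y | I0 y /\ exists n, KP_deg R Lam n y])); apply.
  split; [exact: lincomb0|exact: lincombD|exact: lincombZ|].
  move=> {}x y; move: x; apply: lincomb_ind => [|x z [hx hx'] [hz hz']|a x _ [Ix [m xm]]].
  - by rewrite numul0r numulr0; split; exact: lincomb0.
  - by rewrite numulDl numulDr; split; exact: lincombD.
  move: y (KP_hom_sum fa y); apply: lincomb_ind => [|y z [hy hy'] [hz hz']|b y _ [n yn]].
  - by rewrite numul0r numulr0; split; exact: lincomb0.
  - by rewrite numulDl numulDr; split; exact: lincombD.
  rewrite !numulZl !numulZr; split; do 2!apply: lincombZ;
    rewrite -[_ ** _]scale1r; apply: lincomb_gen => //; split.
  - exact: (nuidealMr hI0).
  - by exists (m + n); exact: KP_degM.
  - exact: (nuidealMl hI0).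
  - by exists (n + m); exact: KP_degM.
move=> y hy; rewrite -[y]scale1r; apply: lincomb_gen => //.
by split; [exact: sub0|exists 0; case: hy].
Qed.

Lemma vertex_lincomb (J : set R) v : rideal J ->
  lincomb J [set: KPA] (s (idp v)) -> J 1.
Proof.
move=> [J0 JD JM] Jv; have [F bF Fv] := bfilter_exists fa v.
pose B : set (set (mor Lam)) := [set F | bfilter F].
have BB G : B G -> bfilter G by [].
have Bt G lam : B G -> G lam -> B (tailf lam G) by exact: bfilter_tailf.
have Bc G lam : B G -> G (idp (src lam)) -> B (consf lam G) by exact: bfilter_consf.
have hfam := boundary_kp_family fa R BB Bt Bc.
have hom := kp_lift_hom hfam.
(* A linear functional maps J KP_R into [J], so one with value 1 at s_v suffices. *)
have [ev [evD evZ ev1]] : exists ev : KPA -> R,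
    [/\ forall x y, ev (x + y) = ev x + ev y,
    forall a x, ev (a *: x) = a * ev x & ev (s (idp v)) = 1].
  exists (fun x =>
    (val (kp_lift (bs R B) (bt R B) x : endo (bspace Lam R)) (fun=> 1)) F).
  split=> [x y|a x|].
  - rewrite (nuhomD hom) endo_addE.
    reflexivity.
  - rewrite (nuhomZ hom).
    rewrite endo_scaleE.
    reflexivity.
  - rewrite (kp_liftE hfam).
    change (@bs_fun k Lam R B (idp v) (fun=> 1) F = 1).
    by rewrite bs_idp// asboolT.
rewrite -ev1; move: Jv; move: (s (idp v)); apply: lincomb_ind => [|x y|a x Ja _].
- suff -> : ev 0 = 0 by exact: J0.
  by apply: (addIr (ev 0)); rewrite -evD !add0r.
- by rewrite evD; exact: JD.
- by rewrite evZ mulrC; exact: JM.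
Qed.

Lemma vertex_ideal_cofinal :
  (forall I : set KPA, nuideal I -> (exists v, I (s (idp v))) -> I = setT) ->
  cofinal Lam.
Proof.
move=> h v m x bx; apply: contrapT => no.
(* The boundary paths with no vertex reachable from [v]. Prepending a path preserves this: a path
   from [v] to an earlier vertex could be continued to a later one. *)
pose B : set (set (mor Lam)) := [set F | bfilter F /\
  forall lam, F lam -> ~ exists rho, rng rho = v /\ src rho = src lam].
have BB G : B G -> bfilter G by case.
have Bt G lam : B G -> G lam -> B (tailf lam G).
  move=> [bG nG] Gl; split; first exact: bfilter_tailf.
  by move=> mu [lm Glm]; rewrite -(src_comp lm); exact: nG.
have Bc G lam : B G -> G (idp (src lam)) -> B (consf lam G).
  move=> [bG nG] Gl; split; first exact: bfilter_consf.
  move=> mu [nu [a [ln Gn ma e]]] [rho [rr sr]]; apply: (nG nu Gn).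
  exists (comp rho a); rewrite rng_comp ?src_comp ?sr//; split=> //.
  by rewrite -(src_comp ma) e src_comp.
have hfam := boundary_kp_family fa R BB Bt Bc.
have hom := kp_lift_hom hfam.
have hom0 : kp_lift (bs R B) (bt R B) 0 = 0.
  by apply: (addIr (kp_lift (bs R B) (bt R B) 0)); rewrite -(nuhomD hom) !add0r.
pose I : set KPA := [set a | kp_lift (bs R B) (bt R B) a = 0].
have hI : nuideal I.
  split=> [|a b Ia Ib|c a Ia|a b Ia].
  - exact: hom0.
  - by apply: etrans (nuhomD hom a b) _; rewrite Ia Ib addr0.
  - by apply: etrans (nuhomZ hom c a) _; rewrite Ia scaler0.
  - split; first by apply: etrans (nuhomM hom a b) _; rewrite Ia numul0r.
    by apply: etrans (nuhomM hom b a) _; rewrite Ia numulr0.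
have Iv : I (s (idp v)).
  rewrite /I /= (kp_liftE hfam); apply: endo_ext => f; apply/funext => G.
  change (bs_fun B (idp v) f G = 0); rewrite bs0// => -[[_ nG] Gv].
  by apply: (nG _ Gv); exists (idp v); rewrite rng_idp.
have IT := h I hI (ex_intro _ v Iv).
pose F := [set lam | exists2 n, lede n m & lam = pmor x 0 n].
have m0 : lede 0 m by move=> i; rewrite ffunE; case: (m i).
have BF : B F.
  split; first exact: bfilter_omega_path.
  move=> _ [n nm ->]; rewrite (pmor_src x (@led0 _ _) nm) => -[rho [rr sr]].
  by apply: no; exists n => //; exists rho.
have F0 : F (idp (pobj x 0)) by exists 0; rewrite // (pmor_id x m0).
have : I (s (idp (pobj x 0))) by rewrite IT.
(* If this vertex acted as zero, the constant function 1, whose value at [F] it preserves, would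
   give 1 = 0 in [R]. *)
rewrite /I /= (kp_liftE hfam).
move=> /(congr1 (fun e : endo (bspace Lam R) => (val e (fun=> 1)) F)).
change (@bs_fun k Lam R B (idp (pobj x 0)) (fun=> 1) F = 0 -> False).
by rewrite bs_idp// asboolT// => /eqP; rewrite oner_eq0.
Qed.

End Implications.

Theorem theorem3p8 (k : nat) (hk : (0 < k)%N) (Lam : kgraph k)
  (hfa : finitely_aligned Lam) (R : comNzRingType) :
  [<-> cofinal Lam;
       forall H : set (vtx Lam), hereditary H -> saturated H ->
         H = set0 \/ H = setT;
       forall I : set (KP R Lam), graded_ideal I ->
         exists2 J : set R, rideal J & I = lincomb J setT;
       forall I : set (KP R Lam), nuideal I ->
         exists2 J : set R, rideal J &
           I `&` KP_deg R Lam 0 `<=` lincomb J setT /\ lincomb J setT `<=` I;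
       forall I : set (KP R Lam), nuideal I ->
         (exists v : vtx Lam, I (kp_s R (idp v))) -> I = setT].
Proof.
tfae.
- by move=> cof H; exact: cofinal_hereditary_saturated.
- by move=> hs I; exact: graded_ideal_lincomb.
- move=> hg I /(degree0_ideal_graded hfa)[I0 /hg[J hJ ->] h].
  by exists J.
- move=> h0 I /h0[J hJ [sub JI]] [v Iv].
  apply/seteqP; split=> // x _; apply: JI.
  rewrite KP_lincombT//; apply: (@vertex_lincomb _ Lam hfa _ _ v) => //.
  apply: sub; split=> //.
  (* Written as s_v t_v, the vertex is visibly a monomial of degree 0. *)
  have -> : kp_s R (idp v) = kp_s R (idp v) ** kp_t R (idp v) :> KP R Lam.
    rewrite (kp_ghost_vtx (KP_kp_family R hfa)) (kp1 (KP_kp_family R hfa)).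
    by rewrite eqxx.
  have -> : 0 = subz (dg (idp v)) (dg (idp v)) :> {ffun 'I_k -> int}.
    by apply/ffunP => i; rewrite subzE subrr ffunE.
  exact: KP_deg_mono.
- exact: vertex_ideal_cofinal.
Qed.
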